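(* Let $g\in H(\mathbb{D})$, let $\nu$ be a weight satisfying property (U) and let $\mu$ be a quasi-normal weight. Then the following are equivalent: (1) $S_g: H^{\infty}_\nu\rightarrow H^{\infty}_\mu$ is bounded; (2) $\sup_{z\in\mathbb{D}}\frac{\mu(z)}{\nu(z)}|g(z)|<\infty$. If, in addition, $\nu$ is typical, then (1) and (2) are also equivalent to (3) $S_g: H^{0}_\nu\rightarrow H^{0}_\mu$ is bounded.
   Context: $\mathbb{D}$ is the open unit disk and $H(\mathbb{D})$ the space of analytic functions on $\mathbb{D}$. A weight is a non-negative continuous function $\nu$ on $\mathbb{D}$ with $\nu(z)=\nu(|z|)$ for all $z$, which is decreasing in $|z|$. For a weight $\nu$: $H^{\infty}_\nu=\{f\in H(\mathbb{D}): \|f\|_{H^\infty_\nu}=\sup_{z}\nu(z)|f(z)|<\infty\}$, $H^{0}_\nu=\{f\in H(\mathbb{D}): \lim_{|z|\to1^-}\nu(z)|f(z)|=0\}$ (with the norm of $H^\infty_\nu$), $\mathcal{B}^{0}_\nu=\{f\in H(\mathbb{D}): \lim_{|z|\to1^-}\nu(z)|f'(z)|=0\}$. A weight $\nu$ is typical if $\lim_{|z|\to1^-}\nu(z)=0$. A weight $\nu$ satisfies property (U) if there is $\alpha>0$ such that $r\mapsto \nu(r)/(1-r^2)^\alpha$ is almost increasing on $[0,1)$ (i.e. there is $C>0$ with $h(r)\le C h(s)$ whenever $r\le s$), equivalently $\inf_n \nu(1-2^{-(n+1)})/\nu(1-2^{-n})>0$. A weight $\mu$ is quasi-normal if $H^0_{\mu}=\mathcal{B}^0_{\mu_1}$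 where $\mu_1(z)=\mu(z)(1-|z|^2)$. For $g\in H(\mathbb{D})$, $(S_gf)(z)=\int_0^z f'(\omega)g(\omega)\,d\omega$. *)

(* Defs.v *)
From Stdlib Require Import Reals ClassicalEpsilon.
From Coquelicot Require Import Coquelicot.
Open Scope R_scope.

Definition inD (z : C) : Prop := Cmod z < 1.

Definition analytic (f : C -> C) : Prop :=
  forall z : C, inD z -> ex_derive f z.

(* the complex derivative f' (meaningful on D for analytic f) *)
Definition Cderiv (f : C -> C) (z : C) : C :=
  epsilon (inhabits (RtoC 0)) (fun l : C => is_derive f z l).

(* A weight is represented by its radial profile nu : [0,1) -> R, nu(z) := nu(|z|):
   non-negative, continuous and decreasing (non-increasing) on [0,1). *)
Definition weight (nu : R -> R) : Prop :=
  (forall r, 0 <= r < 1 -> 0 <= nu r) /\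
  (forall r, 0 <= r < 1 -> forall eps, 0 < eps -> exists delta, 0 < delta /\
     forall s, 0 <= s < 1 -> Rabs (s - r) < delta -> Rabs (nu s - nu r) < eps) /\
  (forall r s, 0 <= r -> r <= s -> s < 1 -> nu s <= nu r).

Definition wt (nu : R -> R) (z : C) : R := nu (Cmod z).

Definition typical (nu : R -> R) : Prop :=
  forall eps, 0 < eps -> exists delta, delta < 1 /\
    forall z, inD z -> delta < Cmod z -> wt nu z < eps.

Definition propU (nu : R -> R) : Prop :=
  exists alpha, 0 < alpha /\ exists K, 0 < K /\
    forall r s, 0 <= r -> r <= s -> s < 1 ->
      nu r / Rpower (1 - r ^ 2) alpha <= K * (nu s / Rpower (1 - s ^ 2) alpha).

Definition inHinf (nu : R -> R) (f : C -> C) : Prop :=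
  analytic f /\ exists M, forall z, inD z -> wt nu z * Cmod (f z) <= M.

Definition Hnorm (nu : R -> R) (f : C -> C) : R :=
  real (Lub_Rbar (fun x => exists z, inD z /\ x = wt nu z * Cmod (f z))).

Definition inH0 (nu : R -> R) (f : C -> C) : Prop :=
  analytic f /\ forall eps, 0 < eps -> exists delta, delta < 1 /\
    forall z, inD z -> delta < Cmod z -> wt nu z * Cmod (f z) < eps.

Definition inB0 (nu : R -> R) (f : C -> C) : Prop :=
  analytic f /\ forall eps, 0 < eps -> exists delta, delta < 1 /\
    forall z, inD z -> delta < Cmod z -> wt nu z * Cmod (Cderiv f z) < eps.

Definition mu1 (mu : R -> R) : R -> R := fun r => mu r * (1 - r ^ 2).

Definition quasi_normal (mu : R -> R) : Prop :=
  forall f : C -> C, inH0 mu f <-> inB0 (mu1 mu) f.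

(* S_g f (z) = int_0^z f'(w) g(w) dw, along the segment [0,z] *)
Definition Sg (g : C -> C) (f : C -> C) : C -> C :=
  fun z => @RInt C_R_CompleteNormedModule
    (fun t : R => Cmult (Cmult (Cderiv f (Cmult (RtoC t) z)) (g (Cmult (RtoC t) z))) z) 0 1.

Definition bounded_op (inX inY : (C -> C) -> Prop) (nuX nuY : R -> R)
    (T : (C -> C) -> (C -> C)) : Prop :=
  exists K, forall f, inX f -> inY (T f) /\ Hnorm nuY (T f) <= K * Hnorm nuX f.

(* Main.v *)
Require Import Defs.
From Stdlib Require Import Reals.
From Coquelicot Require Import Coquelicot.
From Stdlib Require Import Lra Lia Classical ClassicalEpsilon.
Open Scope R_scope.

(** Since [(Sg g f)' = f' g], both implications compare a function with its derivative.
    Property (U) and Cauchy's estimate give [nu (1 - |z|^2) |f'| <= K ||f||_nu], and the functions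
    [f_a z = (1 - |a|^2)^n (z - a) / (1 - conj a z)^(n+1)], with [n] at least the exponent of (U),
    satisfy [||f_a||_nu <= K nu a] and [f_a' a = 1 / (1 - |a|^2)].  Quasi-normality is an
    equality of sets; a gliding hump turns it into the two norm inequalities between
    [sup mu |h|] and [sup mu (1 - |z|^2) |h'|], first on functions vanishing at the boundary and
    then, by the dilations [h (r z)], for all [h] with [h 0 = 0].  (It also forces [mu] to be
    typical, as the constant [1] lies in the little Bloch space.)  A weight [mu] that vanishes
    near the boundary is treated separately: there the inequality bounding [h'] by [h] may fail.

    Functions are only assumed complex differentiable at each point, so Cauchy's estimate is
    obtained from Goursat's bisection argument applied to [(f (z + exp w) - f z) exp (- w)]:
    its integral over a vertical period does not depend on [Re w] and tends to a multiple of
    [f' z] as [Re w] tends to minus infinity. *)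

(** The hypothesis on [mu] compares two sets of functions, all vanishing at the boundary in a
    weighted sense, while (1) concerns the whole space [H^infty_nu] and asks for a constant: this
    gap shapes the proof. It is bridged for functions with [h 0 = 0], a normalization that every
    [S_g f] satisfies and that turns the seminorm of [h'] into one that separates functions. Once
    constants are available, (2) gives [mu (1 - |z|^2) |f' g| <= M nu (1 - |z|^2) |f'|]; conversely
    the derivative of [S_g f_a] at [a] is [g a / (1 - |a|^2)], whose denominator cancels the factor
    in [mu_1]. Weights may have zeros. The gliding hump relies on point evaluations controlled by
    the seminorm, hence on a positive weight. If [mu] vanishes near the boundary, (2) follows from
    compactness when [nu] is positive; when [nu] is identically zero, it follows from the vanishing
    of [S_g f_a] wherever [mu] is positive. *)

#[local] Arguments Cmod x%_C_scope.

(** * Complex derivatives *)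

(* The error is written as a perturbation [e] of the derivative, so that the product and chain
   rules become ring identities. *)
Definition cdiff (f : C -> C) (z l : C) : Prop :=
  forall eps, 0 < eps -> exists delta, 0 < delta /\
    forall k, Cmod k < delta ->
      exists e, Cmod e <= eps /\ f (z + k)%C = (f z + (l + e) * k)%C.

Lemma norm_C_R (z : C) : norm (V := C_R_NormedModule) z = Cmod z.
Proof.
  change (sqrt (Rabs (fst z) ^ 2 + Rabs (snd z) ^ 2) = sqrt (fst z ^ 2 + snd z ^ 2)).
  now rewrite !pow2_abs.
Qed.

Lemma Cmod_nz (k : C) : k <> 0%C -> 0 < Cmod k.
Proof. apply Cmod_gt_0. Qed.

Lemma Cmod_sub_swap (x y : C) : Cmod (x - y) = Cmod (y - x).
Proof. rewrite <- Cmod_opp. f_equal. ring. Qed.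

Lemma Cmod_sub_triangle (x y z : C) : Cmod (x - z) <= Cmod (x - y) + Cmod (y - z).
Proof.
  replace (x - z)%C with ((x - y) + (y - z))%C by ring. apply Cmod_triangle.
Qed.

Lemma Cmod_le_sub (x y : C) : Cmod x <= Cmod y + Cmod (x - y).
Proof.
  replace x with (y + (x - y))%C at 1 by ring. apply Cmod_triangle.
Qed.

Lemma cdiff_bound (f : C -> C) (z l : C) :
  cdiff f z l <->
  (forall eps, 0 < eps -> exists delta, 0 < delta /\
    forall k, Cmod k < delta -> Cmod (f (z + k)%C - f z - l * k) <= eps * Cmod k).
Proof.
  split; intros H eps Heps; destruct (H eps Heps) as (d & Hd & Hk);
    exists d; split; trivial; intros k Hkd.
  - destruct (Hk k Hkd) as (e & He & ->).
    replace (f z + (l + e) * k - f z - l * k)%C with (e * k)%C by ring.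
    rewrite Cmod_mult. apply Rmult_le_compat_r; trivial. apply Cmod_ge_0.
  - destruct (excluded_middle_informative (k = 0%C)) as [-> | Hk0].
    + exists (RtoC 0). rewrite Cmod_0. split; [lra|].
      rewrite Cplus_0_r. ring.
    + exists ((f (z + k) - f z - l * k) / k)%C. split.
      * rewrite Cmod_div by trivial. specialize (Hk k Hkd).
        apply Cmod_nz in Hk0.
        apply Rmult_le_reg_r with (Cmod k); trivial.
        unfold Rdiv. rewrite Rmult_assoc, Rinv_l by lra. lra.
      * field. trivial.
Qed.

(** [C_UniformSpace] is a product, so its balls are squares; passing from squares to round discs
    costs a factor [sqrt 2 < 2], absorbed by halving the radius. *)
Lemma locally_Cmod (z : C) (P : C -> Prop) :
  locally (T := C_UniformSpace) z P <->
  exists delta, 0 < delta /\ forall k, Cmod k < delta -> P (z + k)%C.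
Proof.
  split.
  - intros [d Hd]. exists d. split. apply cond_pos.
    intros k Hk. apply Hd. split; simpl.
    + replace (ball (fst z) d (fst z + fst k)) with (Rabs (fst z + fst k - fst z) < d) by reflexivity.
      replace (fst z + fst k - fst z) with (fst k) by ring.
      apply Rle_lt_trans with (Cmod k); trivial.
      eapply Rle_trans; [|apply Rmax_Cmod]. apply Rmax_l.
    + replace (ball (snd z) d (snd z + snd k)) with (Rabs (snd z + snd k - snd z) < d) by reflexivity.
      replace (snd z + snd k - snd z) with (snd k) by ring.
      apply Rle_lt_trans with (Cmod k); trivial.
      eapply Rle_trans; [|apply Rmax_Cmod]. apply Rmax_r.
  - intros (d & Hd & H).
    assert (Hd2 : 0 < d / 2) by lra.
    exists (mkposreal _ Hd2). intros w [H1 H2].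
    change (Rabs (fst w - fst z) < d / 2) in H1.
    change (Rabs (snd w - snd z) < d / 2) in H2.
    replace w with (z + (w - z))%C by ring. apply H.
    apply Rle_lt_trans with (1 := Cmod_2Rmax _).
    assert (sqrt 2 < 2).
    { rewrite <- (sqrt_square 2) at 2 by lra. apply sqrt_lt_1; lra. }
    simpl fst. simpl snd.
    assert (0 <= sqrt 2) by apply sqrt_pos.
    assert (Rmax (Rabs (fst w + - fst z)) (Rabs (snd w + - snd z)) < d / 2).
    { apply Rmax_lub_lt; trivial. }
    assert (0 <= Rmax (Rabs (fst w + - fst z)) (Rabs (snd w + - snd z))).
    { eapply Rle_trans; [|apply Rmax_l]. apply Rabs_pos. }
    nra.
Qed.

(** Complex differentiation filters through the uniform structure of [C_AbsRing], formally distinct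
    from the product structure of [C_UniformSpace]. *)
Lemma locally_AbsRing_C (z : C) (P : C -> Prop) :
  locally (T := AbsRing_UniformSpace C_AbsRing) z P <->
  exists delta, 0 < delta /\ forall k, Cmod k < delta -> P (z + k)%C.
Proof.
  split.
  - intros [d Hd]. exists d. split. apply cond_pos.
    intros k Hk. apply Hd. change (Cmod (z + k - z) < d).
    now replace (z + k - z)%C with k by ring.
  - intros (d & Hd & H). exists (mkposreal _ Hd). intros w Hw.
    change (Cmod (w - z) < d) in Hw.
    replace w with (z + (w - z))%C by ring. now apply H.
Qed.

Lemma is_derive_cdiff (f : C -> C) (z l : C) :
  is_derive (K := C_AbsRing) (V := C_NormedModule) f z l <-> cdiff f z l.
Proof.
  rewrite cdiff_bound. split.
  - intros [_ H] eps Heps.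
    specialize (H z (fun P H => H) (mkposreal _ Heps)).
    apply locally_AbsRing_C in H. destruct H as (d & Hd & H).
    exists d. split; trivial. intros k Hk. specialize (H k Hk).
    change (Cmod (f (z + k)%C - f z - (z + k - z) * l)%C <= eps * Cmod (z + k - z)%C) in H.
    replace (z + k - z)%C with k in H by ring. now rewrite (Cmult_comm l).
  - intros H. split. apply is_linear_scal_l.
    intros x Hx eps.
    rewrite <- (is_filter_lim_locally_unique (V := AbsRing_NormedModule C_AbsRing) z x Hx).
    apply locally_AbsRing_C. destruct (H eps (cond_pos eps)) as (d & Hd & Hk).
    exists d. split; trivial. intros k Hkd. specialize (Hk k Hkd).
    change (Cmod (f (z + k)%C - f z - (z + k - z) * l)%C <= eps * Cmod (z + k - z)%C).
    replace (z + k - z)%C with k by ring. now rewrite (Cmult_comm k).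
Qed.

Lemma cdiff_unique (f : C -> C) (z l m : C) : cdiff f z l -> cdiff f z m -> l = m.
Proof.
  intros H1 H2. apply is_derive_cdiff, is_C_derive_unique in H1.
  apply is_derive_cdiff, is_C_derive_unique in H2. congruence.
Qed.

Lemma analytic_cdiff (f : C -> C) :
  analytic f <-> forall z, inD z -> cdiff f z (Cderiv f z).
Proof.
  split; intros H z Hz.
  - destruct (H z Hz) as [l Hl]. apply is_derive_cdiff.
    unfold Cderiv. apply epsilon_spec. now exists l.
  - exists (Cderiv f z). now apply is_derive_cdiff, H.
Qed.

Lemma Cderiv_eq (f : C -> C) (z l : C) : cdiff f z l -> Cderiv f z = l.
Proof.
  intros H. apply cdiff_unique with f z; trivial.
  apply is_derive_cdiff. unfold Cderiv. apply epsilon_spec. exists l.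
  now apply is_derive_cdiff.
Qed.

Lemma cdiff_analytic (f d : C -> C) : (forall z, inD z -> cdiff f z (d z)) -> analytic f.
Proof.
  intros H. apply analytic_cdiff. intros z Hz.
  now rewrite (Cderiv_eq _ _ _ (H z Hz)); apply H.
Qed.

Lemma cdiff_ext_loc (f g : C -> C) (z l : C) (r : R) :
  0 < r -> (forall k, Cmod k < r -> f (z + k)%C = g (z + k)%C) ->
  cdiff f z l -> cdiff g z l.
Proof.
  intros Hr E H eps Heps. destruct (H eps Heps) as (d & Hd & Hk).
  exists (Rmin d r). split. now apply Rmin_pos.
  intros k Hkd. assert (Cmod k < d /\ Cmod k < r) as [K1 K2].
  { split; eapply Rlt_le_trans; eauto; [apply Rmin_l|apply Rmin_r]. }
  destruct (Hk k K1) as (e & He & Hf). exists e. split; trivial.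
  rewrite <- E by trivial. rewrite Hf.
  replace (g z) with (f z); trivial.
  specialize (E 0%C). rewrite Cplus_0_r in E. apply E. now rewrite Cmod_0.
Qed.

Lemma cdiff_ext (f g : C -> C) (z l : C) :
  (forall w, f w = g w) -> cdiff f z l -> cdiff g z l.
Proof. intros E. apply cdiff_ext_loc with 1. lra. intros; apply E. Qed.

Lemma cdiff_val (f : C -> C) (z l m : C) : cdiff f z l -> l = m -> cdiff f z m.
Proof. now intros H <-. Qed.

Lemma cdiff_const (c z : C) : cdiff (fun _ => c) z 0.
Proof.
  intros eps Heps. exists 1. split. lra. intros k _. exists 0%C.
  rewrite Cmod_0. split; [lra | ring].
Qed.

Lemma cdiff_id (z : C) : cdiff (fun w => w) z 1.
Proof.
  intros eps Heps. exists 1. split. lra. intros k _. exists 0%C.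
  rewrite Cmod_0. split; [lra | ring].
Qed.

Lemma cdiff_plus (f g : C -> C) (z l m : C) :
  cdiff f z l -> cdiff g z m -> cdiff (fun w => f w + g w)%C z (l + m)%C.
Proof.
  intros H1 H2 eps Heps.
  destruct (H1 (eps / 2)) as (d1 & Hd1 & K1). lra.
  destruct (H2 (eps / 2)) as (d2 & Hd2 & K2). lra.
  exists (Rmin d1 d2). split. now apply Rmin_pos.
  intros k Hk. destruct (K1 k) as (e1 & He1 & E1).
  { eapply Rlt_le_trans; eauto. apply Rmin_l. }
  destruct (K2 k) as (e2 & He2 & E2).
  { eapply Rlt_le_trans; eauto. apply Rmin_r. }
  exists (e1 + e2)%C. split.
  - eapply Rle_trans. apply Cmod_triangle. lra.
  - rewrite E1, E2. ring.
Qed.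

(** The usual source of tolerances below; [d <= 1] lets a product of two errors be absorbed by one
    of them. *)
Lemma small_factor (eps A : R) : 0 < eps -> 0 <= A -> exists d, 0 < d /\ d <= 1 /\ d * A <= eps.
Proof.
  intros He HA. exists (Rmin 1 (eps / (A + 1))).
  assert (0 < eps / (A + 1)) by (apply Rdiv_lt_0_compat; lra).
  split; [apply Rmin_pos; lra|]. split; [apply Rmin_l|].
  apply Rle_trans with (eps / (A + 1) * A).
  - apply Rmult_le_compat_r; trivial. apply Rmin_r.
  - apply Rle_trans with (eps / (A + 1) * (A + 1)); [nra|]. right. field. lra.
Qed.

Lemma cdiff_mult (f g : C -> C) (z l m : C) :
  cdiff f z l -> cdiff g z m -> cdiff (fun w => f w * g w)%C z (l * g z + f z * m)%C.
Proof.
  intros H1 H2 eps Heps.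
  assert (Pf := Cmod_ge_0 (f z)). assert (Pg := Cmod_ge_0 (g z)).
  assert (Pl := Cmod_ge_0 l). assert (Pm := Cmod_ge_0 m).
  destruct (small_factor eps (Cmod (f z) + Cmod (g z) + (Cmod l + 1) * (Cmod m + 1)))
    as (a & Ha & Ha1 & Ha2); trivial. nra.
  destruct (H1 a Ha) as (d1 & Hd1 & K1). destruct (H2 a Ha) as (d2 & Hd2 & K2).
  exists (Rmin a (Rmin d1 d2)). split. repeat apply Rmin_pos; trivial.
  intros k Hk.
  assert (Q1 := Rmin_l a (Rmin d1 d2)). assert (Q2 := Rmin_r a (Rmin d1 d2)).
  assert (Q3 := Rmin_l d1 d2). assert (Q4 := Rmin_r d1 d2).
  destruct (K1 k) as (e1 & He1 & E1). lra.
  destruct (K2 k) as (e2 & He2 & E2). lra.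
  exists (e1 * g z + f z * e2 + (l + e1) * (m + e2) * k)%C. split.
  - eapply Rle_trans. apply Cmod_triangle.
    eapply Rle_trans. apply Rplus_le_compat_r. apply Cmod_triangle.
    rewrite !Cmod_mult.
    assert (T1 := Cmod_triangle l e1). assert (T2 := Cmod_triangle m e2).
    assert (U1 := Cmod_ge_0 (l + e1)). assert (U2 := Cmod_ge_0 (m + e2)).
    assert (U3 := Cmod_ge_0 k).
    assert (Cmod (l + e1) * Cmod (m + e2) <= (Cmod l + 1) * (Cmod m + 1))
      by (apply Rmult_le_compat; lra).
    assert (Cmod (l + e1) * Cmod (m + e2) * Cmod k <= (Cmod l + 1) * (Cmod m + 1) * a).
    { apply Rmult_le_compat; try lra. now apply Rmult_le_pos. }
    nra.
  - rewrite E1, E2. ring.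
Qed.

Lemma cdiff_scal (c : C) (f : C -> C) (z l : C) :
  cdiff f z l -> cdiff (fun w => c * f w)%C z (c * l)%C.
Proof.
  intros H. replace (c * l)%C with (0 * f z + c * l)%C by ring.
  apply cdiff_mult; trivial. apply cdiff_const.
Qed.

Lemma cdiff_minus (f g : C -> C) (z l m : C) :
  cdiff f z l -> cdiff g z m -> cdiff (fun w => f w - g w)%C z (l - m)%C.
Proof.
  intros H1 H2. apply cdiff_ext with (fun w => f w + (- (1)) * g w)%C.
  intros; ring.
  replace (l - m)%C with (l + (- (1)) * m)%C by ring.
  apply cdiff_plus; trivial. now apply cdiff_scal.
Qed.

Lemma cdiff_comp (f g : C -> C) (z l m : C) :
  cdiff f (g z) l -> cdiff g z m -> cdiff (fun w => f (g w)) z (l * m)%C.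
Proof.
  intros H1 H2 eps Heps.
  assert (Pl := Cmod_ge_0 l). assert (Pm := Cmod_ge_0 m).
  destruct (small_factor eps (Cmod l + Cmod m + 1)) as (a & Ha & Ha1 & Ha2); trivial. lra.
  destruct (H1 a Ha) as (d1 & Hd1 & K1). destruct (H2 a Ha) as (d2 & Hd2 & K2).
  destruct (small_factor (d1 / 2) (Cmod m + 1)) as (b & Hb & Hb1 & Hb2); try lra.
  exists (Rmin b d2). split. now apply Rmin_pos.
  intros k Hk. assert (Q1 := Rmin_l b d2). assert (Q2 := Rmin_r b d2).
  destruct (K2 k) as (e2 & He2 & E2). lra.
  assert (T2 := Cmod_triangle m e2).
  assert (U1 := Cmod_ge_0 (m + e2)). assert (U2 := Cmod_ge_0 k).
  destruct (K1 ((m + e2) * k)%C) as (e1 & He1 & E1).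
  { rewrite Cmod_mult.
    apply Rle_lt_trans with ((Cmod m + 1) * b); [apply Rmult_le_compat; lra | lra]. }
  exists (l * e2 + e1 * m + e1 * e2)%C. split.
  - eapply Rle_trans. apply Cmod_triangle.
    eapply Rle_trans. apply Rplus_le_compat_r. apply Cmod_triangle.
    rewrite !Cmod_mult.
    assert (V1 := Cmod_ge_0 e1). assert (V2 := Cmod_ge_0 e2).
    assert (Cmod e1 * Cmod e2 <= a * 1) by (apply Rmult_le_compat; lra).
    nra.
  - rewrite E2, E1. ring.
Qed.

Lemma cdiff_inv (z : C) : z <> 0%C -> cdiff Cinv z (- / (z * z))%C.
Proof.
  intros Hz eps Heps. assert (Pz := Cmod_nz z Hz).
  destruct (small_factor eps (2 * / Cmod z ^ 3)) as (a & Ha & Ha1 & Ha2); trivial.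
  { apply Rmult_le_pos; [lra|]. left. apply Rinv_0_lt_compat. now apply pow_lt. }
  exists (Rmin a (Cmod z / 2)). split. apply Rmin_pos; lra.
  intros k Hk. assert (Q1 := Rmin_l a (Cmod z / 2)). assert (Q2 := Rmin_r a (Cmod z / 2)).
  assert (L : Cmod z / 2 <= Cmod (z + k)).
  { assert (T := Cmod_le_sub z (z + k)%C).
    replace (z - (z + k))%C with (- k)%C in T by ring. rewrite Cmod_opp in T. lra. }
  assert (N : (z + k)%C <> 0%C).
  { intros E. rewrite E, Cmod_0 in L. lra. }
  exists (k / (z * z * (z + k)))%C. split.
  - assert (z * z * (z + k) <> 0)%C by (repeat apply Cmult_neq_0; trivial).
    rewrite Cmod_div by trivial. rewrite !Cmod_mult.
    apply Rle_trans with (a * (2 * / Cmod z ^ 3)); trivial.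
    unfold Rdiv. apply Rmult_le_compat.
    + apply Cmod_ge_0.
    + left. apply Rinv_0_lt_compat. apply Rmult_lt_0_compat; nra.
    + lra.
    + replace (2 * / Cmod z ^ 3) with (/ (Cmod z * Cmod z * (Cmod z / 2))) by (field; lra).
      apply Rinv_le_contravar. apply Rmult_lt_0_compat; nra.
      apply Rmult_le_compat_l; nra.
  - field. split; trivial.
Qed.

Lemma cdiff_cont (f : C -> C) (z l : C) : cdiff f z l ->
  forall eps, 0 < eps -> exists delta, 0 < delta /\
    forall k, Cmod k < delta -> Cmod (f (z + k)%C - f z) < eps.
Proof.
  intros H eps Heps. destruct (H 1) as (d & Hd & K). lra.
  assert (Pl := Cmod_ge_0 l).
  destruct (small_factor (eps / 2) (Cmod l + 1)) as (a & Ha & Ha1 & Ha2); try lra.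
  exists (Rmin a d). split. now apply Rmin_pos.
  intros k Hk. assert (Q1 := Rmin_l a d). assert (Q2 := Rmin_r a d).
  destruct (K k) as (e & He & ->). lra.
  replace (f z + (l + e) * k - f z)%C with ((l + e) * k)%C by ring.
  rewrite Cmod_mult. assert (T := Cmod_triangle l e).
  assert (U1 := Cmod_ge_0 (l + e)). assert (U2 := Cmod_ge_0 k).
  apply Rle_lt_trans with ((Cmod l + 1) * a); [apply Rmult_le_compat; lra | lra].
Qed.

(** * Goursat's theorem *)

(** If [P] failed, choosing again and again a quarter on which it fails would produce nested squares
    shrinking to a point, near which the last hypothesis yields [P]. It serves for Goursat's
    estimate and also as the compactness argument for closed discs. *)
Lemma square_bisection (P : R -> R -> R -> Prop) (x0 y0 l0 : R) :
  0 < l0 ->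
  (forall x y l, 0 < l -> P x y (l / 2) -> P (x + l / 2) y (l / 2) ->
     P x (y + l / 2) (l / 2) -> P (x + l / 2) (y + l / 2) (l / 2) -> P x y l) ->
  (forall p q, x0 <= p <= x0 + l0 -> y0 <= q <= y0 + l0 ->
     exists delta, 0 < delta /\ forall x y l, 0 < l -> l < delta ->
       x <= p <= x + l -> y <= q <= y + l -> P x y l) ->
  P x0 y0 l0.
Proof.
  intros Hl0 Hglue Hloc. apply NNPP. intros Hbad.
  set (L := fun n => l0 / 2 ^ n).
  assert (Lpos : forall n, 0 < L n).
  { intros n. apply Rdiv_lt_0_compat; trivial. apply pow_lt; lra. }
  assert (LS : forall n, L (S n) = L n / 2).
  { intros n. unfold L. simpl. field. apply pow_nonzero. lra. }
  set (good := fun n (s t : R * R) =>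
    ~ P (fst t) (snd t) (L (S n)) /\ fst s <= fst t <= fst s + L (S n) /\
    snd s <= snd t <= snd s + L (S n)).
  set (seq := fix seq n := match n with O => (x0, y0)
    | S m => epsilon (inhabits (x0, y0)) (good m (seq m)) end).
  assert (Hex : forall n s, ~ P (fst s) (snd s) (L n) -> exists t, good n s t).
  { intros n [x y] H. simpl in H. apply NNPP. intros Hno. apply H.
    assert (P0 := Lpos n).
    apply Hglue; trivial; apply NNPP; intros Hc; apply Hno;
      [exists (x, y)|exists (x + L n / 2, y)|exists (x, y + L n / 2)
        |exists (x + L n / 2, y + L n / 2)]; unfold good; rewrite !LS; simpl;
      (split; [exact Hc|lra]). }
  assert (Hbadn : forall n, ~ P (fst (seq n)) (snd (seq n)) (L n)).
  { induction n.
    - unfold L. simpl. now replace (l0 / 1) with l0 by field.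
    - destruct (epsilon_spec (inhabits (x0, y0)) (good n (seq n)) (Hex n _ IHn)) as [H _].
      exact H. }
  assert (Hstep : forall n, good n (seq n) (seq (S n))).
  { intros n. exact (epsilon_spec (inhabits (x0, y0)) (good n (seq n)) (Hex n _ (Hbadn n))). }
  (* The lower corners increase while [a n + L n] decreases, so the limit of the corners lies in
     every interval. It is applied to each coordinate. *)
  assert (key : forall a : nat -> R, (forall n, a n <= a (S n) <= a n + L (S n)) ->
    exists p, forall n, a n <= p <= a n + L n).
  { intros a Ha.
    assert (Hd : forall n m, a (n + m)%nat + L (n + m)%nat <= a n + L n).
    { intros n m. induction m.
      - rewrite Nat.add_0_r. lra.
      - rewrite Nat.add_succ_r. generalize (Ha (n + m)%nat) (LS (n + m)%nat). lra. }
    destruct (ex_finite_lim_seq_incr a (a 0%nat + L 0%nat)) as [p Hp].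
    - intros n. apply Ha.
    - intros n. generalize (Hd 0%nat n) (Lpos n). simpl. lra.
    - exists p. intros n. split.
      + apply (is_lim_seq_incr_compare a p Hp). intros m. apply Ha.
      + apply (is_lim_seq_le (fun m => a (n + m)%nat) (fun _ => a n + L n) p (a n + L n)).
        * intros m. generalize (Hd n m) (Lpos (n + m)%nat). lra.
        * apply is_lim_seq_ext with (fun m => a (m + n)%nat).
          intros m. now rewrite Nat.add_comm. now apply is_lim_seq_incr_n with (N := n) in Hp.
        * apply is_lim_seq_const. }
  destruct (key (fun n => fst (seq n))) as [p Hp]. intros n; apply Hstep.
  destruct (key (fun n => snd (seq n))) as [q Hq]. intros n; apply Hstep.
  destruct (Hloc p q) as (d & Hd & Hloc').
  { generalize (Hp 0%nat). unfold L. simpl. lra. }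
  { generalize (Hq 0%nat). unfold L. simpl. lra. }
  destruct (pow_lt_1_zero (1 / 2)) with (y := d / l0) as [N HN].
  { rewrite Rabs_pos_eq; lra. }
  { now apply Rdiv_lt_0_compat. }
  apply (Hbadn N). apply Hloc'; trivial.
  specialize (HN N (Nat.le_refl N)).
  rewrite Rabs_pos_eq in HN by (apply pow_le; lra).
  unfold L. apply Rmult_lt_reg_r with (/ l0). now apply Rinv_0_lt_compat.
  replace (l0 / 2 ^ N * / l0) with ((1 / 2) ^ N); trivial.
  assert (0 < 2 ^ N) by (apply pow_lt; lra).
  unfold Rdiv at 1. rewrite Rmult_1_l, pow_inv. field. split; lra.
Qed.

(** * Integrals of continuous complex-valued functions on a segment *)

Definition ccont (phi : R -> C) (t : R) : Prop :=
  forall eps, 0 < eps -> exists delta, 0 < delta /\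
    forall h, Rabs h < delta -> Cmod (phi (t + h) - phi t) < eps.

(** Complex values with real scalars, as in [Sg], so that [Sg g f z] is convertible to a [CInt]. *)
Definition CInt (phi : R -> C) (a b : R) : C :=
  @RInt C_R_CompleteNormedModule phi a b.

Lemma ccont_continuous (phi : R -> C) (t : R) :
  ccont phi t -> continuous (T := R_UniformSpace) (U := C_R_NormedModule) phi t.
Proof.
  intros H P HP. apply locally_Cmod in HP. destruct HP as (d & Hd & HP).
  destruct (H d Hd) as (e & He & K). exists (mkposreal e He). intros s Hs.
  change (Rabs (s - t) < e) in Hs.
  replace (phi s) with (phi t + (phi s - phi t))%C by ring. apply HP.
  replace s with (t + (s - t)) by ring. now apply K.
Qed.

Lemma ccont_ex_RInt (phi : R -> C) (a b : R) :
  a <= b -> (forall t, a <= t <= b -> ccont phi t) ->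
  ex_RInt (V := C_R_CompleteNormedModule) phi a b.
Proof.
  intros Hab H. apply (ex_RInt_continuous (V := C_R_CompleteNormedModule)).
  intros t. rewrite Rmin_left, Rmax_right by trivial.
  intros Ht. now apply ccont_continuous, H.
Qed.

Lemma CInt_Chasles (phi : R -> C) (a b c : R) :
  a <= b -> b <= c -> (forall t, a <= t <= c -> ccont phi t) ->
  CInt phi a c = (CInt phi a b + CInt phi b c)%C.
Proof.
  intros H1 H2 H. symmetry.
  apply (RInt_Chasles (V := C_R_CompleteNormedModule)); apply ccont_ex_RInt; trivial;
    intros; apply H; lra.
Qed.

Lemma CInt_minus (phi psi : R -> C) (a b : R) :
  a <= b -> (forall t, a <= t <= b -> ccont phi t) -> (forall t, a <= t <= b -> ccont psi t) ->
  CInt (fun t => phi t - psi t)%C a b = (CInt phi a b - CInt psi a b)%C.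
Proof.
  intros Hab H1 H2.
  apply (RInt_minus (V := C_R_CompleteNormedModule)); now apply ccont_ex_RInt.
Qed.

Lemma CInt_const (c : C) (a b : R) : CInt (fun _ => c) a b = (RtoC (b - a) * c)%C.
Proof.
  unfold CInt. rewrite (RInt_const (V := C_R_CompleteNormedModule)).
  apply scal_R_Cmult.
Qed.

Lemma CInt_bound (phi : R -> C) (a b M : R) :
  a <= b -> (forall t, a <= t <= b -> ccont phi t) ->
  (forall t, a <= t <= b -> Cmod (phi t) <= M) -> Cmod (CInt phi a b) <= (b - a) * M.
Proof.
  intros Hab H HM. rewrite <- norm_C_R.
  apply (norm_RInt_le_const (V := C_R_NormedModule)) with phi; trivial.
  - intros t Ht. rewrite norm_C_R. now apply HM.
  - apply (RInt_correct (V := C_R_CompleteNormedModule)). now apply ccont_ex_RInt.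
Qed.

Lemma CInt_ext (phi psi : R -> C) (a b : R) :
  a <= b -> (forall t, a <= t <= b -> phi t = psi t) -> CInt phi a b = CInt psi a b.
Proof.
  intros Hab H. apply (RInt_ext (V := C_R_CompleteNormedModule)).
  intros t. rewrite Rmin_left, Rmax_right by trivial. intros Ht. apply H. lra.
Qed.

Lemma ccont_const (c : C) (t : R) : ccont (fun _ => c) t.
Proof.
  intros eps He. exists 1. split. lra. intros h _.
  replace (c - c)%C with (RtoC 0) by ring. now rewrite Cmod_0.
Qed.

Lemma ccont_minus (phi psi : R -> C) (t : R) :
  ccont phi t -> ccont psi t -> ccont (fun s => phi s - psi s)%C t.
Proof.
  intros H1 H2 eps He.
  destruct (H1 (eps / 2)) as (d1 & Hd1 & K1). lra.
  destruct (H2 (eps / 2)) as (d2 & Hd2 & K2). lra.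
  exists (Rmin d1 d2). split. now apply Rmin_pos. intros h Hh.
  assert (Q1 := Rmin_l d1 d2). assert (Q2 := Rmin_r d1 d2).
  replace (phi (t + h)%R - psi (t + h)%R - (phi t - psi t))%C
    with ((phi (t + h)%R - phi t) - (psi (t + h)%R - psi t))%C by ring.
  eapply Rle_lt_trans. apply Cmod_triangle. rewrite Cmod_opp.
  specialize (K1 h). specialize (K2 h). lra.
Qed.

Lemma ccont_scal (c : C) (phi : R -> C) (t : R) :
  ccont phi t -> ccont (fun s => c * phi s)%C t.
Proof.
  intros H eps He. assert (Pc := Cmod_ge_0 c).
  destruct (small_factor (eps / 2) (Cmod c)) as (a & Ha & _ & Ha2); try lra.
  destruct (H a Ha) as (d & Hd & K). exists d. split; trivial. intros h Hh.
  replace (c * phi (t + h)%R - c * phi t)%C with (c * (phi (t + h)%R - phi t))%C by ring.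
  rewrite Cmod_mult. specialize (K h Hh). nra.
Qed.

Lemma CInt_near_const (phi : R -> C) (c : C) (a b M : R) :
  a <= b -> (forall t, a <= t <= b -> ccont phi t) ->
  (forall t, a <= t <= b -> Cmod (phi t - c) <= M) ->
  Cmod (CInt phi a b - RtoC (b - a) * c) <= (b - a) * M.
Proof.
  intros Hab H HM. rewrite <- CInt_const, <- CInt_minus; trivial.
  - apply CInt_bound; trivial. intros t Ht. apply ccont_minus. now apply H. apply ccont_const.
  - intros. apply ccont_const.
Qed.

Lemma Rsmall_eq_0 (x K : R) : 0 <= x -> (forall eps, 0 < eps -> x <= K * eps) -> x = 0.
Proof.
  intros Hx H. apply Rle_antisym; trivial. apply Rnot_lt_le. intros Hc.
  destruct (Rle_lt_dec K 0) as [HK|HK].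
  - specialize (H 1). lra.
  - specialize (H (x / (2 * K))).
    replace (K * (x / (2 * K))) with (x / 2) in H by (field; lra).
    assert (0 < x / (2 * K)) by (apply Rdiv_lt_0_compat; lra). lra.
Qed.

Lemma Cmod_Ci : Cmod Ci = 1.
Proof. rewrite <- sqrt_1. unfold Cmod, Ci; simpl. f_equal. ring. Qed.

(* [v p q] stands for [u (a + A p + i B q)], the pull-back of a holomorphic [u] from a rectangle
   with sides [A] and [B] to the unit square. *)
Lemma goursat (v : R -> R -> C) (A B : R) :
  (forall p q, 0 <= p <= 1 -> 0 <= q <= 1 -> exists L,
     forall eps, 0 < eps -> exists delta, 0 < delta /\ forall h k,
       Rabs h < delta -> Rabs k < delta ->
       Cmod (v (p + h) (q + k) - v p q - L * (A * h, B * k)) <= eps * (Rabs h + Rabs k)) ->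
  (CInt (fun t => A * v t 0)%C 0 1 - CInt (fun t => A * v t 1)%C 0 1
   + CInt (fun t => Ci * B * v 1 t)%C 0 1 - CInt (fun t => Ci * B * v 0 t)%C 0 1)%C = 0%C.
Proof.
  intros Hv.
  assert (Hcont : forall p q, 0 <= p <= 1 -> 0 <= q <= 1 -> forall eps, 0 < eps ->
    exists delta, 0 < delta /\ forall h k, Rabs h < delta -> Rabs k < delta ->
      Cmod (v (p + h) (q + k) - v p q) < eps).
  { intros p q Hp Hq eps He. destruct (Hv p q Hp Hq) as [L HL].
    destruct (HL 1) as (d & Hd & K). lra.
    assert (PL := Cmod_ge_0 L). assert (PA := Rabs_pos A). assert (PB := Rabs_pos B).
    set (M := 2 + Cmod L * (Rabs A + Rabs B)).
    assert (HM : 0 <= M) by (unfold M; nra).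
    destruct (small_factor (eps / 2) M) as (a & Ha & _ & Ha2); try lra.
    exists (Rmin a d). split. now apply Rmin_pos. intros h k Hh Hk.
    assert (Q1 := Rmin_l a d). assert (Q2 := Rmin_r a d).
    specialize (K h k ltac:(lra) ltac:(lra)).
    assert (T := Cmod_le_sub (v (p + h) (q + k) - v p q) (L * (A * h, B * k))).
    rewrite Cmod_mult in T.
    assert (T2 : Cmod (A * h, B * k) <= Rabs A * a + Rabs B * a).
    { replace (A * h, B * k) with (RtoC (A * h) + Ci * RtoC (B * k))%C
        by (apply injective_projections; simpl; ring).
      eapply Rle_trans. apply Cmod_triangle. rewrite Cmod_mult, !Cmod_R, !Rabs_mult.
      rewrite Cmod_Ci.
      assert (Rabs A * Rabs h <= Rabs A * a) by (apply Rmult_le_compat_l; lra).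
      assert (Rabs B * Rabs k <= Rabs B * a) by (apply Rmult_le_compat_l; lra). lra. }
    assert (Cmod L * Cmod (A * h, B * k) <= Cmod L * (Rabs A * a + Rabs B * a))
      by (apply Rmult_le_compat_l; lra).
    unfold M in Ha2. nra. }
  assert (Hc1 : forall c q t, 0 <= q <= 1 -> 0 <= t <= 1 -> ccont (fun t => c * v t q)%C t).
  { intros c q t Hq Ht. apply ccont_scal. intros eps He.
    destruct (Hcont t q Ht Hq eps He) as (d & Hd & K). exists d. split; trivial.
    intros h Hh. specialize (K h 0 Hh). rewrite Rplus_0_r in K. apply K. now rewrite Rabs_R0. }
  assert (Hc2 : forall c p t, 0 <= p <= 1 -> 0 <= t <= 1 -> ccont (fun t => c * v p t)%C t).
  { intros c p t Hp Ht. apply ccont_scal. intros eps He.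
    destruct (Hcont p t Hp Ht eps He) as (d & Hd & K). exists d. split; trivial.
    intros h Hh. specialize (K 0 h). rewrite Rplus_0_r in K. apply K; trivial. now rewrite Rabs_R0. }
  (* Boundary integral over the square with corner [(x, y)] and side [l]: bottom minus top, plus
     right minus left. *)
  set (I := fun x y l => (CInt (fun t => A * v t y)%C x (x + l)%R
    - CInt (fun t => A * v t (y + l)%R)%C x (x + l)%R
    + CInt (fun t => Ci * B * v (x + l)%R t)%C y (y + l)%R
    - CInt (fun t => Ci * B * v x t)%C y (y + l)%R)%C).
  assert (main : forall eps, 0 < eps ->
    Cmod (I 0 0 1) <= (4 * (Rabs A + Rabs B)) * eps).
  { intros eps He.
    cut (0 <= 0 -> 0 + 1 <= 1 -> 0 <= 0 -> 0 + 1 <= 1 ->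
      Cmod (I 0 0 1) <= (4 * (Rabs A + Rabs B)) * eps * (1 * 1)).
    { intros H. rewrite !Rmult_1_r in H. apply H; lra. }
    (* The bound is proportional to the area [l * l], hence adds up exactly over four quarters.
       Containment in the unit square is part of the predicate, because differentiability of [v] is
       known only there. *)
    apply (square_bisection (fun x y l => 0 <= x -> x + l <= 1 -> 0 <= y -> y + l <= 1 ->
      Cmod (I x y l) <= (4 * (Rabs A + Rabs B)) * eps * (l * l))). lra.
    - intros x y l Hl P1 P2 P3 P4 X1 X2 Y1 Y2.
      replace (I x y l) with (I x y (l / 2)%R + I (x + l / 2)%R y (l / 2)%R
        + (I x (y + l / 2)%R (l / 2)%R + I (x + l / 2)%R (y + l / 2)%R (l / 2)%R))%C.
      { eapply Rle_trans. apply Cmod_triangle.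
        eapply Rle_trans. apply Rplus_le_compat; apply Cmod_triangle.
        specialize (P1 ltac:(lra) ltac:(lra) ltac:(lra) ltac:(lra)).
        specialize (P2 ltac:(lra) ltac:(lra) ltac:(lra) ltac:(lra)).
        specialize (P3 ltac:(lra) ltac:(lra) ltac:(lra) ltac:(lra)).
        specialize (P4 ltac:(lra) ltac:(lra) ltac:(lra) ltac:(lra)).
        replace (4 * (Rabs A + Rabs B) * eps * (l * l)) with
          (4 * (4 * (Rabs A + Rabs B) * eps * (l / 2 * (l / 2)))) by field. lra. }
      unfold I.
      replace (x + l / 2 + l / 2) with (x + l) by field.
      replace (y + l / 2 + l / 2) with (y + l) by field.
      rewrite (CInt_Chasles (fun t => A * v t y)%C x (x + l / 2) (x + l));
        [|lra|lra|intros; apply Hc1; lra].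
      rewrite (CInt_Chasles (fun t => A * v t (y + l)%R)%C x (x + l / 2) (x + l));
        [|lra|lra|intros; apply Hc1; lra].
      rewrite (CInt_Chasles (fun t => Ci * B * v (x + l)%R t)%C y (y + l / 2) (y + l));
        [|lra|lra|intros; apply Hc2; lra].
      rewrite (CInt_Chasles (fun t => Ci * B * v x t)%C y (y + l / 2) (y + l));
        [|lra|lra|intros; apply Hc2; lra].
      ring.
    - intros p q Hp Hq. destruct (Hv p q ltac:(lra) ltac:(lra)) as [L HL].
      destruct (HL eps He) as (d & Hd & K). exists d. split; trivial.
      intros x y l Hl Hld Hxp Hyq X1 X2 Y1 Y2.
      assert (E : forall s t, x <= s <= x + l -> y <= t <= y + l ->
        Cmod (v s t - v p q - L * (A * (s - p), B * (t - q))%R) <= eps * (2 * l)).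
      { intros s t Hs Ht.
        assert (Rabs (s - p) <= l) by (apply Rabs_le; lra).
        assert (Rabs (t - q) <= l) by (apply Rabs_le; lra).
        specialize (K (s - p) (t - q) ltac:(lra) ltac:(lra)).
        replace (p + (s - p)) with s in K by ring. replace (q + (t - q)) with t in K by ring.
        eapply Rle_trans. exact K. apply Rmult_le_compat_l; lra. }
      unfold I. rewrite <- !CInt_minus; try (intros; apply Hc1; lra); try lra.
      (* The linear part of [v] contributes opposite amounts along the horizontal and the vertical
         sides, so both can be subtracted at no cost; only the error of the linearization
         remains. *)
      replace (CInt (fun t => A * v t y - A * v t (y + l)%R) x (x + l) +
         CInt (fun t => Ci * B * v (x + l)%R t) y (y + l) -
         CInt (fun t => Ci * B * v x t) y (y + l))%C with
        ((CInt (fun t => A * v t y - A * v t (y + l)%R)%C x (x + l)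
           - RtoC (x + l - x) * (- (A * L * (Ci * B * l)))) +
         (CInt (fun t => Ci * B * v (x + l)%R t - Ci * B * v x t)%C y (y + l)
           - RtoC (y + l - y) * (Ci * B * L * (A * l))))%C.
      2:{ rewrite (CInt_minus (fun t => Ci * B * v (x + l)%R t)%C); try (intros; apply Hc2; lra); try lra.
          replace (x + l - x) with l by ring. replace (y + l - y) with l by ring. ring. }
      eapply Rle_trans. apply Cmod_triangle.
      apply Rle_trans with ((x + l - x) * (Rabs A * (4 * l * eps)) + (y + l - y) * (Rabs B * (4 * l * eps))).
      2:{ right. ring. }
      apply Rplus_le_compat.
      + apply CInt_near_const; [lra|intros; apply ccont_minus; apply Hc1; lra|].
        intros t Ht.
        replace (A * v t y - A * v t (y + l)%R - - (A * L * (Ci * B * l)))%C with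
          (A * ((v t y - v p q - L * (A * (t - p), B * (y - q))%R)
            - (v t (y + l)%R - v p q - L * (A * (t - p), B * (y + l - q))%R)))%C.
        2:{ replace (A * (t - p), B * (y + l - q))%R with ((A * (t - p), B * (y - q))%R + Ci * B * l)%C
              by (apply injective_projections; simpl; ring). ring. }
        rewrite Cmod_mult, Cmod_R. apply Rmult_le_compat_l. apply Rabs_pos.
        eapply Rle_trans. apply Cmod_triangle. rewrite Cmod_opp.
        generalize (E t y ltac:(lra) ltac:(lra)) (E t (y + l) ltac:(lra) ltac:(lra)). lra.
      + apply CInt_near_const; [lra|intros; apply ccont_minus; apply Hc2; lra|].
        intros t Ht.
        replace (Ci * B * v (x + l)%R t - Ci * B * v x t - Ci * B * L * (A * l))%C with
          (Ci * (B * ((v (x + l)%R t - v p q - L * (A * (x + l - p), B * (t - q))%R)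
            - (v x t - v p q - L * (A * (x - p), B * (t - q))%R))))%C.
        2:{ replace (A * (x + l - p), B * (t - q))%R with ((A * (x - p), B * (t - q))%R + A * l)%C
              by (apply injective_projections; simpl; ring). ring. }
        rewrite !Cmod_mult, Cmod_R.
        rewrite Cmod_Ci.
        rewrite Rmult_1_l. apply Rmult_le_compat_l. apply Rabs_pos.
        eapply Rle_trans. apply Cmod_triangle. rewrite Cmod_opp.
        generalize (E (x + l) t ltac:(lra) ltac:(lra)) (E x t ltac:(lra) ltac:(lra)). lra. }
  apply Cmod_eq_0. apply Rsmall_eq_0 with (4 * (Rabs A + Rabs B)). apply Cmod_ge_0.
  intros eps He. specialize (main eps He). unfold I in main.
  now rewrite !Rplus_0_l in main.
Qed.

(** * Cauchy's estimate *)

Definition cexp (w : C) : C := (exp (fst w) * cos (snd w), exp (fst w) * sin (snd w))%R.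

Lemma cexp_plus (w k : C) : cexp (w + k) = (cexp w * cexp k)%C.
Proof.
  unfold cexp. simpl. rewrite exp_plus, cos_plus, sin_plus.
  apply injective_projections; simpl; ring.
Qed.

Lemma cexp_0 : cexp 0 = 1%C.
Proof.
  unfold cexp. simpl. rewrite exp_0, cos_0, sin_0.
  apply injective_projections; simpl; ring.
Qed.

Lemma Cmod_cexp (w : C) : Cmod (cexp w) = exp (fst w).
Proof.
  unfold Cmod, cexp. simpl fst. simpl snd.
  replace ((exp (fst w) * cos (snd w)) ^ 2 + (exp (fst w) * sin (snd w)) ^ 2)
    with (exp (fst w) ^ 2 * (Rsqr (sin (snd w)) + Rsqr (cos (snd w)))) by (unfold Rsqr; ring).
  rewrite sin2_cos2, Rmult_1_r. apply sqrt_pow2. left. apply exp_pos.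
Qed.

Lemma Cmod_le_abs (x y : R) : Cmod (x, y) <= Rabs x + Rabs y.
Proof.
  replace (x, y) with (RtoC x + Ci * RtoC y)%C by (apply injective_projections; simpl; ring).
  eapply Rle_trans. apply Cmod_triangle. rewrite Cmod_mult, !Cmod_R, Cmod_Ci. lra.
Qed.

Lemma Rabs_fst_Cmod (z : C) : Rabs (fst z) <= Cmod z.
Proof. eapply Rle_trans; [|apply Rmax_Cmod]. apply Rmax_l. Qed.

Lemma Rabs_snd_Cmod (z : C) : Rabs (snd z) <= Cmod z.
Proof. eapply Rle_trans; [|apply Rmax_Cmod]. apply Rmax_r. Qed.

Lemma derivable_pt_lim_bound (f : R -> R) (x l : R) : derivable_pt_lim f x l ->
  forall eps, 0 < eps -> exists delta, 0 < delta /\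
    forall h, Rabs h < delta -> Rabs (f (x + h) - f x - l * h) <= eps * Rabs h.
Proof.
  intros H eps He. destruct (H eps He) as [d K]. exists d. split. apply cond_pos.
  intros h Hh. destruct (Req_dec h 0) as [->|Hh0].
  - rewrite Rplus_0_r, Rabs_R0. replace (f x - f x - l * 0) with 0 by ring.
    rewrite Rabs_R0. lra.
  - replace (f (x + h) - f x - l * h) with (((f (x + h) - f x) / h - l) * h) by (field; trivial).
    rewrite Rabs_mult. apply Rmult_le_compat_r. apply Rabs_pos. left. now apply K.
Qed.

Lemma cdiff_cexp_0 : cdiff cexp 0 1.
Proof.
  apply cdiff_bound. intros eps0 He0.
  (* The errors below add up to at most [8 * eps * Cmod k], so [eps0 / 20] is ample; the bound
     [1 / 4] gives [|exp x - 1| <= 2 |x|], [|sin y| <= 2 |y|] and [exp x <= 2]. *)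
  set (eps := Rmin (1 / 4) (eps0 / 20)).
  assert (He : 0 < eps) by (apply Rmin_pos; lra).
  assert (Q1 := Rmin_l (1 / 4) (eps0 / 20)). assert (Q2 := Rmin_r (1 / 4) (eps0 / 20)).
  fold eps in Q1, Q2.
  destruct (derivable_pt_lim_bound exp 0 1 derivable_pt_lim_exp_0 eps He) as (d1 & Hd1 & K1).
  destruct (derivable_pt_lim_bound sin 0 1 derivable_pt_lim_sin_0 eps He) as (d2 & Hd2 & K2).
  assert (Hcos := derivable_pt_lim_cos 0).
  rewrite sin_0, Ropp_0 in Hcos.
  destruct (derivable_pt_lim_bound cos 0 0 Hcos eps He) as (d3 & Hd3 & K3).
  exists (Rmin eps (Rmin d1 (Rmin d2 d3))). split. { repeat apply Rmin_pos; trivial; lra. }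
  intros [x y] Hk.
  assert (W1 := Rmin_l eps (Rmin d1 (Rmin d2 d3))). assert (W2 := Rmin_r eps (Rmin d1 (Rmin d2 d3))).
  assert (W3 := Rmin_l d1 (Rmin d2 d3)). assert (W4 := Rmin_r d1 (Rmin d2 d3)).
  assert (W5 := Rmin_l d2 d3). assert (W6 := Rmin_r d2 d3).
  assert (X := Rabs_fst_Cmod (x, y)). assert (Y := Rabs_snd_Cmod (x, y)). simpl in X, Y.
  specialize (K1 x ltac:(lra)). specialize (K2 y ltac:(lra)). specialize (K3 y ltac:(lra)).
  rewrite Rplus_0_l in *. rewrite exp_0 in K1. rewrite sin_0 in K2. rewrite cos_0 in K3.
  rewrite Cplus_0_l, cexp_0. unfold cexp. simpl fst. simpl snd.
  replace ((exp x * cos y, exp x * sin y)%R - 1 - 1 * (x, y))%C with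
    ((exp x - 1 - 1 * x) + exp x * (cos y - 1 - 0 * y),
     (exp x - 1) * sin y + (sin y - 0 - 1 * y)).
  2:{ apply injective_projections; simpl; ring. }
  eapply Rle_trans. apply Cmod_le_abs.
  assert (PX := Rabs_pos x). assert (PY := Rabs_pos y).
  assert (E1 : Rabs (exp x - 1) <= 2 * Rabs x).
  { replace (exp x - 1) with ((exp x - 1 - 1 * x) + x) by ring.
    eapply Rle_trans. apply Rabs_triang. nra. }
  assert (E2 : Rabs (exp x) <= 2).
  { replace (exp x) with ((exp x - 1) + 1) by ring.
    eapply Rle_trans. apply Rabs_triang. rewrite Rabs_R1. lra. }
  assert (S1 : Rabs (sin y) <= 2 * Rabs y).
  { replace (sin y) with ((sin y - 0 - 1 * y) + y) by ring.
    eapply Rle_trans. apply Rabs_triang. nra. }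
  apply Rle_trans with ((eps * Rabs x + 2 * (eps * Rabs y)) + (2 * eps * (2 * Rabs y) + eps * Rabs y)).
  { apply Rplus_le_compat; eapply Rle_trans; try apply Rabs_triang; apply Rplus_le_compat; trivial.
    - rewrite Rabs_mult. apply Rmult_le_compat; trivial; apply Rabs_pos.
    - rewrite Rabs_mult. apply Rmult_le_compat; try apply Rabs_pos; trivial. lra. }
  assert (PK := Cmod_ge_0 (x, y)). nra.
Qed.

Lemma cdiff_cexp (w : C) : cdiff cexp w (cexp w).
Proof.
  apply cdiff_ext with (fun s => cexp w * cexp (s - w))%C.
  { intros s. rewrite <- cexp_plus. f_equal. ring. }
  apply cdiff_val with (cexp w * (1 * (1 - 0)))%C; [|ring].
  apply cdiff_scal. apply (cdiff_comp cexp (fun s => s - w)%C).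
  - replace (w - w)%C with (RtoC 0) by ring. apply cdiff_cexp_0.
  - apply cdiff_minus. apply cdiff_id. apply cdiff_const.
Qed.

Lemma cdiff_ccont_comp (u : C -> C) (phi : R -> C) (t K : R) (l : C) :
  cdiff u (phi t) l -> (forall h, Cmod (phi (t + h)%R - phi t) <= K * Rabs h) ->
  ccont (fun s => u (phi s)) t.
Proof.
  intros Hu Hphi eps He. destruct (cdiff_cont _ _ _ Hu eps He) as (d & Hd & H).
  destruct (small_factor (d / 2) (Rabs K)) as (a & Ha & _ & Ha2); try lra. apply Rabs_pos.
  exists a. split; trivial. intros h Hh.
  specialize (H (phi (t + h)%R - phi t)%C).
  replace (phi t + (phi (t + h)%R - phi t))%C with (phi (t + h)) in H by ring.
  apply H. specialize (Hphi h). assert (T1 := Rle_abs K). assert (T2 := Rabs_pos K).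
  assert (T3 := Rabs_pos h). nra.
Qed.

(* The factor 2 comes from working with [f - f z], which spares computing the integral of
   [exp (- w)]. *)
Lemma cauchy_estimate (f : C -> C) (z d : C) (R0 M : R) :
  0 < R0 -> (forall w, Cmod (w - z) < R0 -> exists l, cdiff f w l) ->
  (forall w, Cmod (w - z) < R0 -> Cmod (f w) <= M) ->
  cdiff f z d -> Cmod d <= 2 * M / R0.
Proof.
  intros HR Hf HM Hd.
  assert (PM : 0 <= M).
  { eapply Rle_trans; [apply (Cmod_ge_0 (f z))|]. apply HM.
    replace (z - z)%C with (RtoC 0) by ring. now rewrite Cmod_0. }
  assert (main : forall r, 0 < r < R0 -> forall eps, 0 < eps -> Cmod d <= 2 * M / r + eps).
  { intros r Hr eps He. destruct (proj1 (cdiff_bound _ _ _) Hd eps He) as (de & Hde & K).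
    (* Radius of the inner circle: inside the disc where [f] is linear up to [eps], and smaller than
       [r]. *)
    set (rho := Rmin de r / 2).
    assert (Q1 := Rmin_l de r). assert (Q2 := Rmin_r de r).
    assert (Q3 : 0 < Rmin de r) by (apply Rmin_pos; lra).
    assert (Hrho : 0 < rho) by (unfold rho; lra).
    set (a := ln rho). set (Aa := ln r - ln rho).
    assert (HA : 0 <= Aa). { unfold Aa. assert (ln rho < ln r) by (apply ln_increasing; unfold rho; lra). lra. }
    (* Under [zeta = z + exp w] the form [u w dw] becomes [(f zeta - f z) / (zeta - z)^2 dzeta], and
       a vertical segment of length [2 * PI] becomes a circle about [z]. *)
    set (u := fun w => ((f (z + cexp w) - f z) * cexp (- w))%C).
    set (v := fun p q => u ((a + Aa * p)%R, (2 * PI * q)%R)).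
    assert (Hu : forall w, exp (fst w) < R0 -> exists l, cdiff u w l).
    { intros w Hw. destruct (Hf (z + cexp w)%C) as [l Hl].
      { replace (z + cexp w - z)%C with (cexp w) by ring. now rewrite Cmod_cexp. }
      eexists. apply cdiff_mult.
      - apply cdiff_minus; [|apply cdiff_const].
        apply (cdiff_comp f (fun w => z + cexp w)%C). exact Hl.
        apply cdiff_plus. apply cdiff_const. apply cdiff_cexp.
      - apply (cdiff_comp cexp (fun w => - w)%C). apply cdiff_cexp.
        apply cdiff_ext with (fun w => - (1) * w)%C. intros; ring. apply cdiff_scal. apply cdiff_id. }
    assert (Hexp : forall p, 0 <= p <= 1 -> exp (a + Aa * p) < R0).
    { intros p Hp. apply Rle_lt_trans with (exp (ln r)). 2: rewrite exp_ln; lra.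
      assert (a + Aa * p <= ln r) by (unfold a, Aa in *; nra).
      destruct H as [H|H]. left; now apply exp_increasing. right; now rewrite H. }
    assert (E1 : exp (a + Aa * 1) = r).
    { unfold a, Aa. replace (ln rho + (ln r - ln rho) * 1) with (ln r) by ring. apply exp_ln. lra. }
    assert (E0 : exp (a + Aa * 0) = rho).
    { unfold a. replace (ln rho + Aa * 0) with (ln rho) by ring. now apply exp_ln. }
    assert (PP := PI_RGT_0).
    assert (G := goursat v Aa (2 * PI)).
    assert (CC : forall p t, 0 <= p <= 1 -> ccont (fun t => Ci * (2 * PI)%R * v p t)%C t).
    { intros p t Hp. apply ccont_scal.
      destruct (Hu ((a + Aa * p)%R, (2 * PI * t)%R)) as [l Hl]. now apply Hexp.
      apply (cdiff_ccont_comp u (fun t => ((a + Aa * p)%R, (2 * PI * t)%R)) t (2 * PI) l); trivial.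
      intros h.
      replace (((a + Aa * p)%R, (2 * PI * (t + h))%R) - ((a + Aa * p)%R, (2 * PI * t)%R))%C
        with (0, 2 * PI * h) by (apply injective_projections; simpl; ring).
      eapply Rle_trans. apply Cmod_le_abs. rewrite Rabs_R0, Rabs_mult, (Rabs_pos_eq (2 * PI)); lra. }
    (* By the period [2 * PI * Ci] of [cexp] the two horizontal sides carry the same values and
       cancel, which leaves the equality of the integrals over the two circles. *)
    rewrite (CInt_ext (fun t => Aa * v t 0)%C (fun t => Aa * v t 1)%C) in G; [|lra|].
    2:{ intros t _. f_equal. unfold v, u.
        assert (EE : forall c, cexp (c, 2 * PI * 0)%R = cexp (c, 2 * PI * 1)%R).
        { intros c. unfold cexp. simpl. rewrite Rmult_0_r, Rmult_1_r, cos_2PI, sin_2PI, cos_0, sin_0. reflexivity. }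
        assert (EE' : forall c, cexp (- (c, 2 * PI * 0)%R) = cexp (- (c, 2 * PI * 1)%R)).
        { intros c. unfold cexp. simpl. rewrite Rmult_0_r, Rmult_1_r, !cos_neg, !sin_neg, cos_2PI, sin_2PI, cos_0, sin_0.
          f_equal; ring. }
        now rewrite EE, EE'. }
    assert (G1 : CInt (fun t => Ci * (2 * PI)%R * v 1 t)%C 0 1 = CInt (fun t => Ci * (2 * PI)%R * v 0 t)%C 0 1).
    { apply Ceq_minus. rewrite <- G.
      - ring.
      - intros p q Hp Hq. destruct (Hu ((a + Aa * p)%R, (2 * PI * q)%R)) as [L HL]. now apply Hexp.
        exists L. intros e Hee. pose proof (proj1 (cdiff_bound _ _ _) HL) as HL'.
        set (S := Rabs Aa + 2 * PI). assert (HS : 0 < S) by (unfold S; generalize (Rabs_pos Aa); lra).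
        destruct (HL' (e / S)) as (d1 & Hd1 & K1). now apply Rdiv_lt_0_compat.
        exists (d1 / (2 * S)). split. apply Rdiv_lt_0_compat; lra.
        intros h k Hh Hk.
        assert (T : Cmod (Aa * h, 2 * PI * k)%R <= S * (Rabs h + Rabs k)).
        { eapply Rle_trans. apply Cmod_le_abs. rewrite !Rabs_mult, (Rabs_pos_eq 2), (Rabs_pos_eq PI) by lra.
          unfold S. generalize (Rabs_pos h) (Rabs_pos k) (Rabs_pos Aa). nra. }
        unfold v.
        replace ((a + Aa * (p + h))%R, (2 * PI * (q + k))%R) with
          (((a + Aa * p)%R, (2 * PI * q)%R) + (Aa * h, 2 * PI * k)%R)%C
          by (apply injective_projections; simpl; ring).
        eapply Rle_trans. apply K1.
        + eapply Rle_lt_trans. exact T. apply Rlt_le_trans with (S * (d1 / (2 * S) + d1 / (2 * S))).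
          apply Rmult_lt_compat_l; lra. right. field. lra.
        + apply Rle_trans with (e / S * (S * (Rabs h + Rabs k))).
          * apply Rmult_le_compat_l; trivial. left; now apply Rdiv_lt_0_compat.
          * right. field. lra. }
    assert (Hc : Cmod (Ci * (2 * PI)%R) = 2 * PI).
    { rewrite Cmod_mult, Cmod_Ci, Cmod_R, Rabs_pos_eq; lra. }
    assert (B1 : Cmod (CInt (fun t => Ci * (2 * PI)%R * v 1 t)%C 0 1) <= (1 - 0) * (2 * PI * (2 * M / r))).
    { apply CInt_bound. lra. intros; apply CC; lra. intros t _. rewrite Cmod_mult, Hc.
      apply Rmult_le_compat_l. lra. unfold v, u. rewrite Cmod_mult, Cmod_cexp. simpl fst.
      rewrite exp_Ropp, E1. unfold Rdiv. apply Rmult_le_compat_r. left; apply Rinv_0_lt_compat; lra.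
      eapply Rle_trans. apply Cmod_triangle. rewrite Cmod_opp.
      assert (Cmod (f (z + cexp ((a + Aa * 1)%R, (2 * PI * t)%R))%C) <= M).
      { apply HM. match goal with |- Cmod (z + ?x - z) < _ => replace (z + x - z)%C with x by ring end.
        rewrite Cmod_cexp. simpl fst. rewrite E1. lra. }
      assert (Cmod (f z) <= M).
      { apply HM. replace (z - z)%C with (RtoC 0) by ring. now rewrite Cmod_0. }
      lra. }
    (* On the inner circle [u] is within [eps] of [d]; on the outer one it was bounded by
       [2 * M / r]. Equality of the integrals then bounds [d]. *)
    assert (B0 : Cmod (CInt (fun t => Ci * (2 * PI)%R * v 0 t)%C 0 1 - RtoC (1 - 0) * (Ci * (2 * PI)%R * d))
       <= (1 - 0) * (2 * PI * eps)).
    { apply CInt_near_const. lra. intros; apply CC; lra. intros t _.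
      replace (Ci * (2 * PI)%R * v 0 t - Ci * (2 * PI)%R * d)%C with (Ci * (2 * PI)%R * (v 0 t - d))%C by ring.
      rewrite Cmod_mult, Hc. apply Rmult_le_compat_l. lra.
      unfold v, u. set (w := ((a + Aa * 0)%R, (2 * PI * t)%R)).
      assert (Ew : (cexp w * cexp (- w) = 1)%C).
      { rewrite <- cexp_plus. replace (w + - w)%C with (RtoC 0) by ring. apply cexp_0. }
      replace ((f (z + cexp w) - f z) * cexp (- w) - d)%C with
        ((f (z + cexp w) - f z - d * cexp w) * cexp (- w))%C.
      2:{ transitivity ((f (z + cexp w) - f z) * cexp (- w) - d * (cexp w * cexp (- w)))%C. ring.
          rewrite Ew. ring. }
      assert (Mw : Cmod (cexp w) = rho) by (rewrite Cmod_cexp; exact E0).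
      rewrite Cmod_mult. rewrite (Cmod_cexp (- w)). simpl fst.
      rewrite exp_Ropp. change (exp (a + Aa * 0)) with (exp (fst w)). rewrite <- (Cmod_cexp w), Mw.
      specialize (K (cexp w)). rewrite Mw in K.
      apply Rle_trans with (eps * rho * / rho).
      - apply Rmult_le_compat_r. left; now apply Rinv_0_lt_compat. apply K. unfold rho. lra.
      - right. field. lra. }
    rewrite <- G1 in B0.
    assert (T := Cmod_le_sub (RtoC (1 - 0) * (Ci * (2 * PI)%R * d)) (CInt (fun t => Ci * (2 * PI)%R * v 1 t)%C 0 1)).
    rewrite Cmod_sub_swap in T.
    rewrite 2 Cmod_mult, Cmod_R, Hc in T. rewrite Rminus_0_r, Rabs_R1 in *.
    apply Rmult_le_reg_l with (2 * PI); [lra|]. lra. }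
  (* Here [r] tends to [R0]: the radius is chosen so that [2 * M / r] equals [2 * M / R0 + e / 2].
     For [M = 0] this choice would give radius 0, hence the case split. *)
  apply le_epsilon. intros e He.
  destruct (Req_dec M 0) as [->|HM0].
  - generalize (main (R0 / 2) ltac:(lra) e He). unfold Rdiv. rewrite Rmult_0_r, !Rmult_0_l. lra.
  - assert (0 < M) by lra.
    set (X := 2 * M / R0). assert (HX : 0 < X) by (apply Rdiv_lt_0_compat; lra).
    assert (Hr : 0 < 2 * M / (X + e / 2) < R0).
    { split. apply Rdiv_lt_0_compat; lra.
      apply Rmult_lt_reg_r with (X + e / 2). lra.
      unfold Rdiv at 1. rewrite Rmult_assoc, Rinv_l, Rmult_1_r by lra.
      replace (2 * M) with (R0 * X) by (unfold X; field; lra). nra. }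
    specialize (main _ Hr (e / 2) ltac:(lra)).
    replace (2 * M / (2 * M / (X + e / 2))) with (X + e / 2) in main by (field; lra). lra.
Qed.

(** * Consequences for analytic functions *)

(** The real mean value theorem is applied along the segment to the real part of [Cconj D * f],
    where [D] is the increment of [f]: the increment of this real function is [Cmod D ^ 2], and one
    factor [Cmod D] cancels. *)
Lemma mean_value_inequality (f : C -> C) (z k : C) (M : R) :
  (forall t, 0 <= t <= 1 -> cdiff f (z + RtoC t * k)%C (Cderiv f (z + RtoC t * k)%C) /\
     Cmod (Cderiv f (z + RtoC t * k)%C) <= M) ->
  Cmod (f (z + k)%C - f z) <= M * Cmod k.
Proof.
  intros H. set (D := (f (z + k)%C - f z)%C).
  assert (PD := Cmod_ge_0 D). assert (Pk := Cmod_ge_0 k).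
  set (psi := fun t => fst (Cconj D * f (z + RtoC t * k))%C).
  set (dpsi := fun t => fst (Cconj D * (Cderiv f (z + RtoC t * k) * k))%C).
  destruct (MVT_cor2 psi dpsi 0 1) as (c & Hc & Hc1). lra.
  { intros t Ht eps He. destruct (H t Ht) as [Hd _].
    destruct (small_factor (eps / 2) (Cmod D * Cmod k)) as (a & Ha & _ & Ha2); try lra. nra.
    destruct (proj1 (cdiff_bound _ _ _) Hd a Ha) as (d & Hdp & K).
    destruct (small_factor (d / 2) (Cmod k)) as (b & Hb & _ & Hb2); try lra.
    exists (mkposreal b Hb). intros h Hh Hhb. simpl in Hhb.
    replace ((psi (t + h) - psi t) / h - dpsi t) with ((psi (t + h) - psi t - h * dpsi t) / h) by (field; trivial).
    unfold Rdiv. rewrite Rabs_mult, Rabs_inv.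
    assert (Ph : 0 < Rabs h) by now apply Rabs_pos_lt.
    apply Rmult_lt_reg_r with (Rabs h); trivial. rewrite Rmult_assoc, Rinv_l, Rmult_1_r by lra.
    specialize (K (RtoC h * k)%C). rewrite Cmod_mult, Cmod_R in K.
    assert (Kh : Rabs h * Cmod k < d) by nra. specialize (K Kh).
    replace (psi (t + h) - psi t - h * dpsi t) with
      (fst (Cconj D * (f (z + RtoC t * k + RtoC h * k) - f (z + RtoC t * k)
        - Cderiv f (z + RtoC t * k) * (RtoC h * k)))%C).
    2:{ unfold psi, dpsi. rewrite RtoC_plus.
        replace (z + (RtoC t + RtoC h) * k)%C with (z + RtoC t * k + RtoC h * k)%C by ring.
        simpl. ring. }
    eapply Rle_lt_trans. apply Rabs_fst_Cmod. rewrite Cmod_mult, Cmod_conj.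
    apply Rle_lt_trans with (Cmod D * (a * (Rabs h * Cmod k))).
    - now apply Rmult_le_compat_l.
    - apply Rle_lt_trans with (eps / 2 * Rabs h); [|nra].
      replace (Cmod D * (a * (Rabs h * Cmod k))) with (a * (Cmod D * Cmod k) * Rabs h) by ring.
      apply Rmult_le_compat_r; lra. }
  assert (E : psi 1 - psi 0 = Cmod D ^ 2).
  { unfold psi. replace (z + RtoC 1 * k)%C with (z + k)%C by ring.
    replace (z + RtoC 0 * k)%C with z by ring.
    assert (E2 := Cmod2_conj D). apply (f_equal fst) in E2. change (fst (RtoC (Cmod D ^ 2))) with (Cmod D ^ 2) in E2.
    rewrite E2. unfold D. simpl. ring. }
  rewrite E in Hc.
  assert (Hb : dpsi c <= Cmod D * (M * Cmod k)).
  { unfold dpsi. eapply Rle_trans. apply Rle_abs. eapply Rle_trans. apply Rabs_fst_Cmod.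
    rewrite !Cmod_mult, Cmod_conj. apply Rmult_le_compat_l; trivial. apply Rmult_le_compat_r; trivial.
    apply H. lra. }
  assert (0 <= M) by (eapply Rle_trans; [apply Cmod_ge_0 | apply (H 0); lra]).
  destruct (Req_dec (Cmod D) 0) as [->|Hn]. nra.
  apply Rmult_le_reg_l with (Cmod D); [lra|]. nra.
Qed.

Definition diffon (f : C -> C) (z : C) (r : R) : Prop :=
  forall w, Cmod (w - z) < r -> cdiff f w (Cderiv f w).

Lemma Cderiv_bound (f : C -> C) (z : C) (r M : R) :
  0 < r -> diffon f z r -> (forall w, Cmod (w - z) < r -> Cmod (f w) <= M) ->
  Cmod (Cderiv f z) <= 2 * M / r.
Proof.
  intros Hr Hf HM. apply cauchy_estimate with f z; trivial.
  - intros w Hw. eexists. now apply Hf.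
  - apply Hf. replace (z - z)%C with (RtoC 0) by ring. now rewrite Cmod_0.
Qed.

Lemma Cmod_segment (t : R) (k : C) : 0 <= t <= 1 -> Cmod (RtoC t * k) <= Cmod k.
Proof.
  intros Ht. rewrite Cmod_mult, Cmod_R, Rabs_pos_eq by lra. assert (P := Cmod_ge_0 k). nra.
Qed.

(** Cauchy's estimate is applied to the increment [f (w + k) - f w], since a second derivative is
    not yet available. On the half disc [|f'| <= 4 * M / r], so the increment is at most
    [4 * M / r * Cmod k], and Cauchy on radius [r / 4] produces the constant 32. *)
Lemma Cderiv_lipschitz (f : C -> C) (z k : C) (r M : R) :
  0 < r -> diffon f z r -> (forall w, Cmod (w - z) < r -> Cmod (f w) <= M) ->
  Cmod k < r / 4 -> Cmod (Cderiv f (z + k)%C - Cderiv f z) <= 32 * M / r ^ 2 * Cmod k.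
Proof.
  intros Hr Hf HM Hk. assert (Pk := Cmod_ge_0 k).
  assert (B : forall w, Cmod (w - z) < r / 2 -> Cmod (Cderiv f w) <= 4 * M / r).
  { intros w Hw. replace (4 * M / r) with (2 * M / (r / 2)) by (field; lra).
    apply Cderiv_bound; [lra| |]; intros w' Hw'; [apply Hf | apply HM];
      (eapply Rle_lt_trans; [apply (Cmod_sub_triangle _ w)|]; lra). }
  assert (Dg : forall w, Cmod (w - z) < r / 4 ->
    cdiff (fun w => f (w + k) - f w)%C w (Cderiv f (w + k) - Cderiv f w)%C).
  { intros w Hw. apply cdiff_minus. 2:{ apply Hf. lra. }
    apply cdiff_val with (Cderiv f (w + k) * (1 + 0))%C; [|ring].
    apply (cdiff_comp f (fun w => w + k)%C).
    - apply Hf. replace (w + k - z)%C with ((w - z) + k)%C by ring.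
      eapply Rle_lt_trans. apply Cmod_triangle. lra.
    - apply cdiff_plus. apply cdiff_id. apply cdiff_const. }
  replace (32 * M / r ^ 2 * Cmod k) with (2 * (4 * M / r * Cmod k) / (r / 4)) by (field; lra).
  apply cauchy_estimate with (fun w => f (w + k) - f w)%C z; [lra| | |].
  - intros w Hw. eexists. apply Dg. trivial.
  - intros w Hw. apply (mean_value_inequality f). intros t Ht.
    assert (T : Cmod (w + RtoC t * k - z) < r / 2).
    { replace (w + RtoC t * k - z)%C with ((w - z) + RtoC t * k)%C by ring.
      eapply Rle_lt_trans. apply Cmod_triangle. generalize (Cmod_segment t k Ht). lra. }
    split. apply Hf. lra. now apply B.
  - apply Dg. replace (z - z)%C with (RtoC 0) by ring. rewrite Cmod_0. lra.
Qed.

(** The mean value inequality for [f w - Cderiv f z * w]. The constant depends on [f] only through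
    the bound [M], which is what lets the estimate pass to limits. *)
Lemma taylor_remainder (f : C -> C) (z k : C) (r M : R) :
  0 < r -> diffon f z r -> (forall w, Cmod (w - z) < r -> Cmod (f w) <= M) ->
  Cmod k < r / 4 ->
  Cmod (f (z + k)%C - f z - Cderiv f z * k) <= 32 * M / r ^ 2 * Cmod k * Cmod k.
Proof.
  intros Hr Hf HM Hk. assert (Pk := Cmod_ge_0 k).
  assert (P0 : 0 <= M).
  { eapply Rle_trans; [apply (Cmod_ge_0 (f z))|]. apply HM.
    replace (z - z)%C with (RtoC 0) by ring. now rewrite Cmod_0. }
  assert (PM : 0 <= 32 * M / r ^ 2).
  { apply Rmult_le_pos; [lra|]. left. apply Rinv_0_lt_compat. now apply pow_lt. }
  replace (f (z + k) - f z - Cderiv f z * k)%C with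
    ((fun w => f w - Cderiv f z * w) (z + k) - (fun w => f w - Cderiv f z * w) z)%C by (simpl; ring).
  apply (mean_value_inequality (fun w => f w - Cderiv f z * w)%C). intros t Ht. assert (S := Cmod_segment t k Ht).
  assert (E : cdiff (fun w => f w - Cderiv f z * w)%C (z + RtoC t * k)%C
    (Cderiv f (z + RtoC t * k) - Cderiv f z)%C).
  { apply cdiff_minus.
    - apply Hf. replace (z + RtoC t * k - z)%C with (RtoC t * k)%C by ring. lra.
    - apply cdiff_val with (Cderiv f z * 1)%C; [|ring]. apply cdiff_scal. apply cdiff_id. }
  rewrite (Cderiv_eq _ _ _ E). split; trivial.
  eapply Rle_trans. apply (Cderiv_lipschitz f z (RtoC t * k) r M); trivial. lra.
  now apply Rmult_le_compat_l.
Qed.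

(** * Convergent complex sequences and locally uniform limits *)

Definition Cconv (s : nat -> C) (l : C) : Prop :=
  forall eps, 0 < eps -> exists N, forall n, (N <= n)%nat -> Cmod (s n - l) <= eps.

Lemma Cconv_cauchy (s : nat -> C) :
  (forall eps, 0 < eps -> exists N, forall n, (N <= n)%nat -> Cmod (s n - s N) <= eps) ->
  exists l, Cconv s l.
Proof.
  intros H.
  assert (key : forall u : C -> R, (forall x y, u (x - y)%C = u x - u y) ->
    (forall z, Rabs (u z) <= Cmod z) -> exists l, Un_cv (fun n => u (s n)) l).
  { intros u Hu Hb. destruct (Rcomplete.R_complete (fun n => u (s n))) as [l Hl]; [|now exists l].
    intros eps He. destruct (H (eps / 4)) as [N HN]. lra.
    exists N. intros n m Hn Hm. unfold Rdist. rewrite <- Hu.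
    eapply Rle_lt_trans. apply Hb. eapply Rle_lt_trans. apply (Cmod_sub_triangle _ (s N)).
    rewrite (Cmod_sub_swap (s N)). generalize (HN n Hn) (HN m Hm). lra. }
  destruct (key fst) as [a Ha]. reflexivity. apply Rabs_fst_Cmod.
  destruct (key snd) as [b Hb]. reflexivity. apply Rabs_snd_Cmod.
  exists (a, b). intros eps He.
  destruct (Ha (eps / 2)) as [N1 H1]. lra. destruct (Hb (eps / 2)) as [N2 H2]. lra.
  exists (max N1 N2). intros n Hn.
  specialize (H1 n ltac:(lia)). specialize (H2 n ltac:(lia)). unfold Rdist in *.
  destruct (s n) as [x y]. eapply Rle_trans. apply (Cmod_le_abs (x + - a) (y + - b)).
  simpl in *. unfold Rminus in *. lra.
Qed.

Lemma Cconv_ext (s t : nat -> C) (l : C) : (forall n, s n = t n) -> Cconv s l -> Cconv t l.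
Proof.
  intros E H eps He. destruct (H eps He) as [N HN]. exists N. intros n Hn. rewrite <- E. now apply HN.
Qed.

Lemma Cconv_const (c : C) : Cconv (fun _ => c) c.
Proof.
  intros eps He. exists O. intros n _. replace (c - c)%C with (RtoC 0) by ring. rewrite Cmod_0. lra.
Qed.

Lemma Cconv_plus (s t : nat -> C) (l m : C) : Cconv s l -> Cconv t m -> Cconv (fun n => s n + t n)%C (l + m)%C.
Proof.
  intros H1 H2 eps He. destruct (H1 (eps / 2)) as [N1 K1]. lra. destruct (H2 (eps / 2)) as [N2 K2]. lra.
  exists (max N1 N2). intros n Hn. specialize (K1 n ltac:(lia)). specialize (K2 n ltac:(lia)).
  replace (s n + t n - (l + m))%C with ((s n - l) + (t n - m))%C by ring.
  eapply Rle_trans. apply Cmod_triangle. lra.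
Qed.

Lemma Cconv_scal (c : C) (s : nat -> C) (l : C) : Cconv s l -> Cconv (fun n => c * s n)%C (c * l)%C.
Proof.
  intros H eps He. destruct (small_factor eps (Cmod c)) as (a & Ha & _ & Ha2); trivial. apply Cmod_ge_0.
  destruct (H a Ha) as [N K]. exists N. intros n Hn. specialize (K n Hn).
  replace (c * s n - c * l)%C with (c * (s n - l))%C by ring. rewrite Cmod_mult.
  assert (P := Cmod_ge_0 c). nra.
Qed.

Lemma Cconv_minus (s t : nat -> C) (l m : C) : Cconv s l -> Cconv t m -> Cconv (fun n => s n - t n)%C (l - m)%C.
Proof.
  intros H1 H2. apply Cconv_ext with (fun n => s n + (- (1)) * t n)%C. intros; ring.
  replace (l - m)%C with (l + (- (1)) * m)%C by ring. apply Cconv_plus; trivial. now apply Cconv_scal.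
Qed.

Lemma Cconv_Cmod_le (s : nat -> C) (l : C) (B : R) (N : nat) :
  Cconv s l -> (forall n, (N <= n)%nat -> Cmod (s n) <= B) -> Cmod l <= B.
Proof.
  intros H HB. apply le_epsilon. intros e He. destruct (H e He) as [K HK].
  specialize (HK (max N K) ltac:(lia)). specialize (HB (max N K) ltac:(lia)).
  assert (T := Cmod_le_sub l (s (max N K))). rewrite Cmod_sub_swap in T. lra.
Qed.

(* A Weierstrass convergence theorem: the uniform second-order Taylor bound passes to the limit. *)
Lemma cdiff_uniform_limit (fn : nat -> C -> C) (f : C -> C) (z : C) (r : R) (b : nat -> R) :
  0 < r -> (forall n, diffon (fn n) z r) ->
  (forall n m w, (n <= m)%nat -> Cmod (w - z) < r -> Cmod (fn m w - fn n w) <= b n) ->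
  (forall eps, 0 < eps -> exists n, b n <= eps) ->
  (forall w, Cmod (w - z) < r -> Cconv (fun n => fn n w) (f w)) ->
  exists l, cdiff f z l /\ Cconv (fun n => Cderiv (fn n) z) l.
Proof.
  intros Hr Hd Hb Hb0 Hl.
  assert (Z : forall s, 0 < s -> Cmod (z - z) < s).
  { intros s Hs. replace (z - z)%C with (RtoC 0) by ring. now rewrite Cmod_0. }
  assert (Dm : forall n m w, Cmod (w - z) < r ->
    cdiff (fun w => fn m w - fn n w)%C w (Cderiv (fn m) w - Cderiv (fn n) w)%C).
  { intros n m w Hw. apply cdiff_minus; now apply Hd. }
  assert (Dmon : forall n m, diffon (fun w => fn m w - fn n w)%C z r).
  { intros n m w Hw. rewrite (Cderiv_eq _ _ _ (Dm n m w Hw)). now apply Dm. }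
  assert (CD : forall n m, (n <= m)%nat -> Cmod (Cderiv (fn m) z - Cderiv (fn n) z) <= 2 * b n / r).
  { intros n m Hnm. rewrite <- (Cderiv_eq _ _ _ (Dm n m z (Z r Hr))).
    apply Cderiv_bound; trivial. intros w Hw. now apply Hb. }
  destruct (Cconv_cauchy (fun n => Cderiv (fn n) z)) as [l Hlim].
  { intros eps He. destruct (Hb0 (eps * r / 2)) as [n Hn]. apply Rdiv_lt_0_compat; nra.
    exists n. intros m Hm. eapply Rle_trans. now apply CD.
    apply Rmult_le_reg_r with r; trivial. unfold Rdiv. rewrite Rmult_assoc, Rinv_l by lra. lra. }
  exists l. split; trivial.
  assert (Z0 := Z r Hr).
  (* The Taylor bound needs a common bound on the functions. None is assumed for [fn n], but the
     differences [fn n - fn 0] are bounded by [b 0], so [fn 0] is split off. *)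
  apply cdiff_ext with (fun w => fn 0%nat w + (f w - fn 0%nat w))%C. intros; ring.
  apply cdiff_val with (Cderiv (fn 0%nat) z + (l - Cderiv (fn 0%nat) z))%C; [|ring].
  apply cdiff_plus. apply Hd; trivial.
  apply cdiff_bound. intros eps He.
  assert (B0 : 0 <= b 0%nat).
  { eapply Rle_trans. 2: apply (Hb 0%nat 0%nat z); trivial. apply Cmod_ge_0. }
  assert (Pr : 0 < r ^ 2) by now apply pow_lt.
  assert (PB : 0 <= 32 * b 0%nat / r ^ 2).
  { apply Rmult_le_pos; [lra|]. left. now apply Rinv_0_lt_compat. }
  destruct (small_factor eps (32 * b 0%nat / r ^ 2)) as (a & Ha & _ & Ha2); trivial.
  exists (Rmin a (r / 4)). split. apply Rmin_pos; lra. intros k Hk.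
  assert (Q1 := Rmin_l a (r / 4)). assert (Q2 := Rmin_r a (r / 4)). assert (Pk := Cmod_ge_0 k).
  apply Rle_trans with (32 * b 0%nat / r ^ 2 * Cmod k * Cmod k).
  2:{ apply Rmult_le_compat_r; trivial. nra. }
  assert (Zk : Cmod (z + k - z) < r) by (replace (z + k - z)%C with k by ring; lra).
  apply Cconv_Cmod_le with (s := fun n => (fn n (z + k) - fn 0%nat (z + k) - (fn n z - fn 0%nat z)
    - (Cderiv (fn n) z - Cderiv (fn 0%nat) z) * k)%C) (N := O).
  - apply Cconv_minus.
    + apply Cconv_minus; (apply Cconv_minus; [apply Hl; trivial | apply Cconv_const]).
    + apply Cconv_ext with (fun n => k * (Cderiv (fn n) z - Cderiv (fn 0%nat) z))%C. intros; ring.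
      replace ((l - Cderiv (fn 0%nat) z) * k)%C with (k * (l - Cderiv (fn 0%nat) z))%C by ring.
      apply Cconv_scal. apply Cconv_minus; trivial. apply Cconv_const.
  - intros n _. rewrite <- (Cderiv_eq _ _ _ (Dm 0%nat n z Z0)).
    apply (taylor_remainder (fun w => fn n w - fn 0%nat w)%C); trivial; try lra.
    intros w Hw. apply Hb; trivial. lia.
Qed.

(** Compactness of the closed disc by bisection of [[-1, 1]^2]: near a point of the unit disc
    continuity gives a bound, and near any other point small squares miss the disc of radius
    [rho]. *)
Lemma analytic_bounded (f : C -> C) (rho : R) :
  analytic f -> rho < 1 -> exists M, forall z, Cmod z <= rho -> Cmod (f z) <= M.
Proof.
  intros Hf Hrho.
  assert (H : exists M, forall z, -1 <= fst z <= -1 + 2 -> -1 <= snd z <= -1 + 2 ->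
    Cmod z <= rho -> Cmod (f z) <= M).
  { apply (square_bisection (fun x y l => exists M, forall z, x <= fst z <= x + l ->
      y <= snd z <= y + l -> Cmod z <= rho -> Cmod (f z) <= M)). lra.
    - intros x y l Hl [M1 H1] [M2 H2] [M3 H3] [M4 H4].
      exists (Rmax (Rmax M1 M2) (Rmax M3 M4)). intros z Hx Hy Hz.
      assert (T1 := Rmax_l M1 M2). assert (T2 := Rmax_r M1 M2).
      assert (T3 := Rmax_l M3 M4). assert (T4 := Rmax_r M3 M4).
      assert (T5 := Rmax_l (Rmax M1 M2) (Rmax M3 M4)). assert (T6 := Rmax_r (Rmax M1 M2) (Rmax M3 M4)).
      destruct (Rle_dec (fst z) (x + l / 2)), (Rle_dec (snd z) (y + l / 2)).
      + specialize (H1 z ltac:(lra) ltac:(lra) Hz). lra.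
      + specialize (H3 z ltac:(lra) ltac:(lra) Hz). lra.
      + specialize (H2 z ltac:(lra) ltac:(lra) Hz). lra.
      + specialize (H4 z ltac:(lra) ltac:(lra) Hz). lra.
    - intros p q _ _.
      assert (near : forall x y l z, x <= p <= x + l -> y <= q <= y + l ->
        x <= fst z <= x + l -> y <= snd z <= y + l -> Cmod (z - (p, q)) <= l + l).
      { intros x y l [a b] H1 H2 H3 H4. simpl in *.
        eapply Rle_trans. apply (Cmod_le_abs (a + - p) (b + - q)).
        apply Rplus_le_compat; apply Rabs_le; lra. }
      destruct (Rlt_dec (Cmod (p, q)) 1) as [Hin|Hout].
      + destruct (Hf (p, q) Hin) as [l Hl]. apply is_derive_cdiff in Hl.
        destruct (cdiff_cont _ _ _ Hl 1) as (d & Hd & K). lra.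
        exists (d / 2). split. lra. intros x y s Hs Hsd H1 H2.
        exists (Cmod (f (p, q)) + 1). intros z Hx Hy Hz.
        specialize (K (z - (p, q))%C). assert (EE : forall c w : C, (c + (w - c))%C = w) by (intros; ring). rewrite EE in K.
        specialize (near x y s z H1 H2 Hx Hy).
        assert (T := Cmod_le_sub (f z) (f (p, q))). specialize (K ltac:(lra)). lra.
      + exists ((1 - rho) / 2). split. lra. intros x y s Hs Hsd H1 H2.
        exists 0. intros z Hx Hy Hz. exfalso. specialize (near x y s z H1 H2 Hx Hy).
        assert (T := Cmod_le_sub (p, q) z). rewrite Cmod_sub_swap in T. lra. }
  destruct H as [M HM]. exists M. intros z Hz.
  assert (F := Rabs_fst_Cmod z). assert (S := Rabs_snd_Cmod z).
  apply HM; trivial.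
  - assert (T : Rabs (fst z) <= 1) by lra. apply Rabs_le_between in T. lra.
  - assert (T : Rabs (snd z) <= 1) by lra. apply Rabs_le_between in T. lra.
Qed.

Lemma analytic_diffon (f : C -> C) (z : C) (r : R) : analytic f -> Cmod z + r <= 1 -> diffon f z r.
Proof.
  intros Hf Hr w Hw. apply analytic_cdiff; trivial. unfold inD.
  assert (T := Cmod_le_sub w z). lra.
Qed.

(** The difference quotients [fn n] with steps [kn n] tending to 0 are analytic near [z], and the
    Taylor remainder bounds their distance to [f'] by [Q * kn n] uniformly there; the limit theorem
    then applies. *)
Lemma Cderiv_analytic (f : C -> C) : analytic f -> analytic (Cderiv f).
Proof.
  intros Hf z Hz. unfold inD in Hz. assert (Pz := Cmod_ge_0 z).
  set (r := (1 - Cmod z) / 4). assert (Hr : 0 < r) by (unfold r; lra).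
  destruct (analytic_bounded f (Cmod z + 2 * r) Hf) as [M HM]. unfold r; lra.
  assert (PM : 0 <= M). { eapply Rle_trans; [apply (Cmod_ge_0 (f z))|]. apply HM. lra. }
  set (kn := fun n => r / 8 / (INR n + 1)).
  assert (Pn : forall n, 0 < INR n + 1) by (intros n; generalize (pos_INR n); lra).
  assert (Pkn : forall n, 0 < kn n) by (intros n; apply Rdiv_lt_0_compat; trivial; lra).
  assert (Kdec : forall n m, (n <= m)%nat -> kn m <= kn n).
  { intros n m Hnm. apply le_INR in Hnm. unfold kn. apply Rmult_le_compat_l. lra.
    apply Rinv_le_contravar; trivial. lra. }
  assert (Kr : forall n, kn n < r / 4).
  { intros n. apply Rle_lt_trans with (r / 8); [|lra]. unfold kn.
    unfold Rdiv at 1. rewrite <- (Rmult_1_r (r / 8)) at 2. apply Rmult_le_compat_l. lra.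
    rewrite <- Rinv_1. apply Rinv_le_contravar. lra. generalize (pos_INR n). lra. }
  set (fn := fun n w => ((f (w + kn n) - f w) / kn n)%C).
  set (Q := 32 * M / r ^ 2).
  assert (PQ : 0 <= Q).
  { apply Rmult_le_pos; [lra|]. left. apply Rinv_0_lt_compat. now apply pow_lt. }
  assert (Knz : forall n, RtoC (kn n) <> 0%C).
  { intros n E. apply RtoC_inj in E. generalize (Pkn n). lra. }
  assert (Happ : forall n w, Cmod (w - z) < r -> Cmod (fn n w - Cderiv f w) <= Q * kn n).
  { intros n w Hw. assert (T := Cmod_le_sub w z).
    assert (Ck : Cmod (kn n) = kn n) by (rewrite Cmod_R, Rabs_pos_eq; generalize (Pkn n); lra).
    assert (E := taylor_remainder f w (kn n) r M Hr).
    rewrite Ck in E.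
    replace (fn n w - Cderiv f w)%C with ((f (w + kn n) - f w - Cderiv f w * kn n) / kn n)%C
      by (unfold fn; field; trivial).
    rewrite Cmod_div, Ck by trivial.
    apply Rmult_le_reg_r with (kn n); trivial. unfold Rdiv. rewrite Rmult_assoc, Rinv_l, Rmult_1_r
      by (generalize (Pkn n); lra).
    apply E; trivial.
    - apply analytic_diffon; trivial. unfold r in *. lra.
    - intros w' Hw'. apply HM. assert (T' := Cmod_le_sub w' w). lra. }
  assert (Hsmall : forall eps, 0 < eps -> exists N, forall n, (N <= n)%nat -> 2 * (Q * kn n) <= eps).
  { intros eps He. destruct (small_factor eps (2 * Q)) as (a & Ha & _ & Ha2); try lra.
    destruct (nfloor_ex (r / 8 / a)) as [N [_ HN]]. left; apply Rdiv_lt_0_compat; lra.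
    exists N. intros n Hn. apply Kdec in Hn. assert (kn N <= a).
    { unfold kn. apply Rmult_le_reg_r with (INR N + 1); trivial.
      unfold Rdiv at 1. rewrite Rmult_assoc, Rinv_l, Rmult_1_r by (generalize (Pn N); lra).
      apply Rmult_lt_compat_r with (r := a) in HN; trivial. unfold Rdiv at 1 in HN.
      rewrite Rmult_assoc, Rinv_l in HN by lra. lra. }
    nra. }
  destruct (cdiff_uniform_limit fn (Cderiv f) z r (fun n => 2 * (Q * kn n))) as (l & Hl & _); trivial.
  - intros n w Hw. assert (T := Cmod_le_sub w z).
    assert (E : cdiff (fn n) w ((/ kn n) * (Cderiv f (w + kn n) * (1 + 0) - Cderiv f w))%C).
    { apply cdiff_ext with (fun w => / kn n * (f (w + kn n) - f w))%C.
      intros s; unfold fn, Cdiv; ring.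
      apply cdiff_scal. apply cdiff_minus.
      - apply (cdiff_comp f (fun w => w + kn n)%C).
        + apply analytic_cdiff; trivial. unfold inD. eapply Rle_lt_trans. apply Cmod_triangle.
          rewrite Cmod_R, Rabs_pos_eq by (generalize (Pkn n); lra).
          generalize (Kr n). unfold r in *. lra.
        + apply cdiff_plus. apply cdiff_id. apply cdiff_const.
      - apply analytic_cdiff; trivial. unfold inD, r in *. lra. }
    now rewrite (Cderiv_eq _ _ _ E).
  - intros n m w Hnm Hw. eapply Rle_trans. apply (Cmod_sub_triangle _ (Cderiv f w)).
    rewrite (Cmod_sub_swap (Cderiv f w)).
    generalize (Happ n w Hw) (Happ m w Hw) (Kdec n m Hnm). nra.
  - intros eps He. destruct (Hsmall eps He) as [N HN]. exists N. now apply HN.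
  - intros w Hw eps He. destruct (Hsmall eps He) as [N HN]. exists N. intros n Hn.
    eapply Rle_trans. now apply Happ. generalize (HN n Hn) (Pkn n). nra.
  - exists l. now apply is_derive_cdiff.
Qed.

(** * Primitives along segments from the origin, and the derivative of [S_g f] *)

Lemma CInt_FTC (U u : C -> C) :
  (forall t, 0 <= t <= 1 -> cdiff U (RtoC t) (u (RtoC t))) ->
  (forall t, 0 <= t <= 1 -> exists l, cdiff u (RtoC t) l) ->
  CInt (fun t => u (RtoC t)) 0 1 = (U 1 - U 0)%C.
Proof.
  intros HU Hu. apply (is_RInt_unique (V := C_R_CompleteNormedModule)).
  apply (is_RInt_derive (V := C_R_CompleteNormedModule) (fun t => U (RtoC t)) (fun t => u (RtoC t)) 0 1);
    rewrite Rmin_left, Rmax_right by lra; intros t Ht.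
  - split. apply is_linear_scal_l.
    intros x Hx eps. rewrite <- (is_filter_lim_locally_unique (V := R_NormedModule) t x Hx).
    destruct (proj1 (cdiff_bound _ _ _) (HU t Ht) eps (cond_pos eps)) as (d & Hd & K).
    exists (mkposreal d Hd). intros s Hs. change (Rabs (s - t) < d) in Hs.
    rewrite norm_C_R. specialize (K (RtoC (s - t))). rewrite Cmod_R in K. specialize (K Hs).
    change (norm (minus s t)) with (Rabs (s - t)).
    replace (RtoC t + RtoC (s - t))%C with (RtoC s) in K by (rewrite RtoC_minus; ring).
    eapply Rle_trans; [|exact K]. right. f_equal.
    change (scal (minus s t) (u (RtoC t))) with (scal (V := C_R_ModuleSpace) (s - t) (u (RtoC t))).
    rewrite scal_R_Cmult. rewrite (Cmult_comm (u (RtoC t))). reflexivity.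
  - apply ccont_continuous. destruct (Hu t Ht) as [l Hl].
    apply (cdiff_ccont_comp u RtoC t 1 l Hl). intros h. rewrite <- RtoC_minus, Cmod_R.
    replace (t + h - t) with h by ring. lra.
Qed.

Lemma cdiff_line (F : C -> C) (l z : C) (t : C) :
  cdiff F (t * z)%C l -> cdiff (fun s => F (s * z))%C t (l * z)%C.
Proof.
  intros H. apply (cdiff_comp F (fun s => s * z)%C); trivial.
  apply cdiff_val with (1 * z + t * 0)%C; [|ring]. apply cdiff_mult. apply cdiff_id. apply cdiff_const.
Qed.

Lemma inD_segment (t : R) (z : C) : 0 <= t <= 1 -> inD z -> inD (RtoC t * z).
Proof. intros Ht Hz. eapply Rle_lt_trans. now apply Cmod_segment. exact Hz. Qed.

(** Differentiation under the integral sign: the part of the integrand linear in [k] is the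
    derivative in [t] of [k * (t * F (t * z))], so it integrates exactly to [k * F z]. *)
Lemma cdiff_primitive (F : C -> C) (z : C) : analytic F -> inD z ->
  cdiff (fun w => CInt (fun t => F (RtoC t * w) * w)%C 0 1) z (F z).
Proof.
  intros HF Hz. assert (HF' := Cderiv_analytic F HF).
  assert (DF := proj1 (analytic_cdiff F) HF). assert (DF' := proj1 (analytic_cdiff _) HF').
  unfold inD in Hz. assert (Pz := Cmod_ge_0 z).
  set (r := (1 - Cmod z) / 2). assert (Hr : 0 < r) by (unfold r; lra).
  destruct (analytic_bounded F (Cmod z + r) HF) as [M HM]. unfold r; lra.
  destruct (analytic_bounded (Cderiv F) (Cmod z) HF') as [M' HM']. trivial.
  assert (PM : 0 <= M). { eapply Rle_trans; [apply (Cmod_ge_0 (F z))|]. apply HM. lra. }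
  assert (PM' : 0 <= M'). { eapply Rle_trans; [apply (Cmod_ge_0 (Cderiv F z))|]. apply HM'. lra. }
  set (Q := 32 * M / r ^ 2).
  assert (PQ : 0 <= Q).
  { apply Rmult_le_pos; [lra|]. left. apply Rinv_0_lt_compat. now apply pow_lt. }
  set (G := fun w => CInt (fun t => F (RtoC t * w) * w)%C 0 1).
  assert (cc : forall w t, inD w -> 0 <= t <= 1 -> ccont (fun t => F (RtoC t * w) * w)%C t).
  { intros w t Hw Ht.
    apply (cdiff_ccont_comp (fun s => F (s * w) * w)%C RtoC t 1 (Cderiv F (RtoC t * w) * w * w + F (RtoC t * w) * 0)%C).
    - apply (cdiff_mult (fun s => F (s * w))%C (fun _ => w)); [|apply cdiff_const]. apply (cdiff_line F). apply DF. now apply inD_segment.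
    - intros h. rewrite <- RtoC_minus, Cmod_R. replace (t + h - t) with h by ring. lra. }
  assert (cc2 : forall k t, 0 <= t <= 1 -> exists l,
    cdiff (fun s => k * (F (s * z) + s * (Cderiv F (s * z) * z)))%C (RtoC t) l).
  { intros k t Ht. eexists. apply cdiff_scal. apply cdiff_plus.
    - apply (cdiff_line F). apply DF. now apply inD_segment.
    - apply (cdiff_mult (fun s => s) (fun s => Cderiv F (s * z) * z)%C). apply cdiff_id. apply (cdiff_mult (fun s => Cderiv F (s * z))%C (fun _ => z)); [|apply cdiff_const].
      apply (cdiff_line (Cderiv F)). apply DF'. now apply inD_segment. }
  assert (cc3 : forall k t, 0 <= t <= 1 ->
    ccont (fun t => k * (F (RtoC t * z) + RtoC t * (Cderiv F (RtoC t * z) * z)))%C t).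
  { intros k t Ht. destruct (cc2 k t Ht) as [l Hl].
    apply (cdiff_ccont_comp _ RtoC t 1 l Hl).
    intros h. rewrite <- RtoC_minus, Cmod_R. replace (t + h - t) with h by ring. lra. }
  assert (FTC : forall k, CInt (fun t => k * (F (RtoC t * z) + RtoC t * (Cderiv F (RtoC t * z) * z)))%C 0 1
     = (k * F z)%C).
  { intros k.
    rewrite (CInt_FTC (fun s => k * (s * F (s * z)))%C
      (fun s => k * (F (s * z) + s * (Cderiv F (s * z) * z)))%C).
    - replace (1 * z)%C with z by ring. ring.
    - intros t Ht. apply cdiff_scal.
      apply cdiff_val with (1 * F (RtoC t * z) + RtoC t * (Cderiv F (RtoC t * z) * z))%C; [|ring].
      apply (cdiff_mult (fun s => s) (fun s => F (s * z))%C). apply cdiff_id. apply (cdiff_line F). apply DF. now apply inD_segment.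
    - intros t Ht. now apply cc2. }
  apply cdiff_bound. intros eps He. fold G.
  destruct (small_factor eps (2 * Q + M')) as (a & Ha & _ & Ha2); trivial. lra.
  exists (Rmin a (r / 4)). split. apply Rmin_pos; lra. intros k Hk.
  assert (Q1 := Rmin_l a (r / 4)). assert (Q2 := Rmin_r a (r / 4)). assert (Pk := Cmod_ge_0 k).
  assert (Zk : Cmod (z + k) < 1).
  { eapply Rle_lt_trans. apply Cmod_triangle. unfold r in *; lra. }
  replace (F z * k)%C with (k * F z)%C by ring. rewrite <- (FTC k). unfold G.
  rewrite <- CInt_minus; [|lra|intros; now apply cc|intros; now apply cc].
  rewrite <- CInt_minus; [|lra|intros; apply ccont_minus; now apply cc|intros; now apply cc3].
  apply Rle_trans with ((1 - 0) * ((2 * Q + M') * Cmod k * Cmod k)).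
  2:{ rewrite Rminus_0_r, Rmult_1_l. apply Rmult_le_compat_r; trivial. nra. }
  apply CInt_bound. lra.
  { intros t Ht. apply ccont_minus; [apply ccont_minus; now apply cc | now apply cc3]. }
  intros t Ht. assert (Sk := Cmod_segment t k Ht). assert (Sz := Cmod_segment t z Ht).
  (* The remainder is the Taylor error of [F] at [t * z], times [z + k], plus a term with the factor
     [k] twice: both are quadratic in [k]. *)
  replace (F (RtoC t * (z + k)) * (z + k) - F (RtoC t * z) * z -
    k * (F (RtoC t * z) + RtoC t * (Cderiv F (RtoC t * z) * z)))%C with
    ((F (RtoC t * z + RtoC t * k) - F (RtoC t * z) - Cderiv F (RtoC t * z) * (RtoC t * k)) * (z + k)
     + Cderiv F (RtoC t * z) * (RtoC t * k) * k)%C.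
  2:{ replace (RtoC t * (z + k))%C with (RtoC t * z + RtoC t * k)%C by ring. ring. }
  eapply Rle_trans. apply Cmod_triangle.
  rewrite (Cmod_mult _ (z + k)), (Cmod_mult _ k), (Cmod_mult (Cderiv F _)), (Cmod_mult (RtoC t) k).
  assert (T := taylor_remainder F (RtoC t * z) (RtoC t * k) r M Hr).
  assert (T2 : Cmod (F (RtoC t * z + RtoC t * k)%C - F (RtoC t * z)%C - Cderiv F (RtoC t * z)%C * (RtoC t * k)) <= Q * Cmod k * Cmod k).
  { eapply Rle_trans. apply T.
    - apply analytic_diffon; trivial. unfold r; lra.
    - intros w Hw. apply HM. assert (W := Cmod_le_sub w (RtoC t * z)). lra.
    - lra.
    - fold Q. assert (Pt := Cmod_ge_0 (RtoC t * k)).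
      apply Rmult_le_compat; trivial; nra. }
  assert (T3 := HM' (RtoC t * z)%C ltac:(lra)).
  rewrite Cmod_mult in Sk.
  assert (P1 := Cmod_ge_0 (Cderiv F (RtoC t * z)%C)). assert (P2 := Cmod_ge_0 (z + k)).
  assert (P3 := Cmod_ge_0 (RtoC t)).
  assert (X1 : Q * Cmod k * Cmod k * Cmod (z + k) <= Q * Cmod k * Cmod k * 2).
  { apply Rmult_le_compat_l; [|lra]. apply Rmult_le_pos; [apply Rmult_le_pos|]; trivial. }
  assert (X2 : Cmod (Cderiv F (RtoC t * z)%C) * (Cmod (RtoC t) * Cmod k) <= M' * Cmod k).
  { apply Rmult_le_compat; trivial. now apply Rmult_le_pos. }
  assert (X3 : Cmod (F (RtoC t * z + RtoC t * k)%C - F (RtoC t * z)%C - Cderiv F (RtoC t * z)%C * (RtoC t * k)) * Cmod (z + k) <= Q * Cmod k * Cmod k * Cmod (z + k)).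
  { now apply Rmult_le_compat_r. }
  assert (X4 : Cmod (Cderiv F (RtoC t * z)%C) * (Cmod (RtoC t) * Cmod k) * Cmod k <= M' * Cmod k * Cmod k).
  { now apply Rmult_le_compat_r. }
  lra.
Qed.

Lemma Sg_cdiff (g f : C -> C) (z : C) : analytic g -> analytic f -> inD z ->
  cdiff (Sg g f) z (Cderiv f z * g z)%C.
Proof.
  intros Hg Hf Hz. apply (cdiff_primitive (fun w => Cderiv f w * g w)%C); trivial.
  assert (Hf' := Cderiv_analytic f Hf).
  apply cdiff_analytic with (fun w => Cderiv (Cderiv f) w * g w + Cderiv f w * Cderiv g w)%C.
  intros w Hw. apply cdiff_mult; now apply analytic_cdiff.
Qed.

Lemma Sg_0 (g f : C -> C) : Sg g f 0 = 0%C.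
Proof.
  transitivity (CInt (fun _ => RtoC 0) 0 1).
  - apply CInt_ext. lra. intros t _. simpl. ring.
  - rewrite CInt_const. ring.
Qed.

(** * From qualitative to uniform bounds *)

Definition jet (b : bool) (h : C -> C) (z : C) : C := if b then Cderiv h z else h z.

Lemma cdiff_lin (c : C) (h1 h2 : C -> C) (z : C) : analytic h1 -> analytic h2 -> inD z ->
  cdiff (fun w => h1 w + c * h2 w)%C z (Cderiv h1 z + c * Cderiv h2 z)%C.
Proof.
  intros H1 H2 Hz. apply cdiff_plus; [|apply cdiff_scal]; now apply analytic_cdiff.
Qed.

Lemma analytic_lin (c : C) (h1 h2 : C -> C) : analytic h1 -> analytic h2 ->
  analytic (fun w => h1 w + c * h2 w)%C.
Proof.
  intros H1 H2. apply cdiff_analytic with (fun z => Cderiv h1 z + c * Cderiv h2 z)%C.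
  intros z Hz. now apply cdiff_lin.
Qed.

Lemma jet_lin (b : bool) (c : C) (h1 h2 : C -> C) (z : C) : analytic h1 -> analytic h2 -> inD z ->
  jet b (fun w => h1 w + c * h2 w)%C z = (jet b h1 z + c * jet b h2 z)%C.
Proof.
  intros H1 H2 Hz. destruct b; simpl; trivial. now apply Cderiv_eq, cdiff_lin.
Qed.

Lemma jet_analytic (b : bool) (h : C -> C) : analytic h -> analytic (jet b h).
Proof. destruct b; simpl; trivial. apply Cderiv_analytic. Qed.

Lemma cdiff_dilate (r : R) (h : C -> C) (z : C) : 0 <= r <= 1 -> analytic h -> inD z ->
  cdiff (fun w => h (RtoC r * w)%C) z (RtoC r * Cderiv h (RtoC r * z))%C.
Proof.
  intros Hr Hh Hz. apply cdiff_val with (Cderiv h (RtoC r * z) * (RtoC r * 1))%C; [|ring].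
  apply (cdiff_comp h (fun w => RtoC r * w)%C).
  - apply analytic_cdiff; trivial. now apply inD_segment.
  - apply cdiff_scal. apply cdiff_id.
Qed.

Lemma analytic_dilate (r : R) (h : C -> C) : 0 <= r <= 1 -> analytic h ->
  analytic (fun w => h (RtoC r * w)%C).
Proof.
  intros Hr Hh. apply cdiff_analytic with (fun z => RtoC r * Cderiv h (RtoC r * z))%C.
  intros z Hz. now apply cdiff_dilate.
Qed.

Lemma jet_dilate (b : bool) (r : R) (h : C -> C) (z : C) : 0 <= r <= 1 -> analytic h -> inD z ->
  jet b (fun w => h (RtoC r * w)%C) z = ((if b then RtoC r else 1) * jet b h (RtoC r * z))%C.
Proof.
  intros Hr Hh Hz. destruct b; simpl; [|ring]. now apply Cderiv_eq, cdiff_dilate.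
Qed.

(** Convertible to the second half of [inH0] when [F] is [h], and of [inB0] when [F] is [Cderiv h];
    quasi-normality thus applies directly to [jet]. *)
Definition vanishes (p : R -> R) (F : C -> C) : Prop :=
  forall eps, 0 < eps -> exists delta, delta < 1 /\
    forall z, inD z -> delta < Cmod z -> wt p z * Cmod (F z) < eps.

Definition bounded_by (p : R -> R) (F : C -> C) (N : R) : Prop :=
  forall z, inD z -> wt p z * Cmod (F z) <= N.

Definition decreasing_profile (p : R -> R) : Prop :=
  (forall r, 0 <= r < 1 -> 0 <= p r) /\
  (forall r s, 0 <= r -> r <= s -> s < 1 -> p s <= p r).

Lemma wt_ge_0 (p : R -> R) (z : C) : decreasing_profile p -> inD z -> 0 <= wt p z.
Proof. intros [H _] Hz. apply H. split. apply Cmod_ge_0. exact Hz. Qed.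

Lemma wt_le (p : R -> R) (z w : C) : decreasing_profile p -> inD z -> Cmod w <= Cmod z ->
  wt p z <= wt p w.
Proof. intros [_ H] Hz Hw. apply H; trivial. apply Cmod_ge_0. Qed.

Lemma inD_0 : inD 0.
Proof. unfold inD. rewrite Cmod_0. lra. Qed.

Lemma vanishes_bounded (p : R -> R) (F : C -> C) : decreasing_profile p -> analytic F ->
  vanishes p F -> exists M, bounded_by p F M.
Proof.
  intros Hp HF H. destruct (H 1) as (d & Hd & K). lra.
  destruct (analytic_bounded F d HF Hd) as [M HM].
  exists (Rmax 1 (wt p 0 * Rmax 0 M)). intros z Hz.
  destruct (Rlt_le_dec d (Cmod z)) as [Hz'|Hz'].
  - eapply Rle_trans; [|apply Rmax_l]. left. now apply K.
  - eapply Rle_trans; [|apply Rmax_r]. apply Rmult_le_compat.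
    + now apply wt_ge_0.
    + apply Cmod_ge_0.
    + apply wt_le; trivial. rewrite Cmod_0. apply Cmod_ge_0.
    + eapply Rle_trans; [|apply Rmax_r]. now apply HM.
Qed.

(* Used with [p], [b] measuring [h'] and [q], [b'] measuring [h], and the other way round. *)
Section UniformBoundedness.

Context (b b' : bool) (p q : R -> R).
Context (Hp : decreasing_profile p) (Htyp : typical p) (Hq : decreasing_profile q).
(** The [p]-seminorm controls [h] uniformly on smaller discs. This is the source of completeness and
    of continuous point evaluations; positivity of the weight will provide it. *)
Context (Hloc : forall rho, rho < 1 -> exists L, 0 <= L /\ forall h N,
  analytic h -> h 0%C = 0%C -> bounded_by p (jet b h) N ->
  forall z, Cmod z <= rho -> Cmod (h z) <= L * N).

(** The Banach space in which the gliding hump takes place; [h 0 = 0] removes the constants, which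
    the seminorm of [h'] does not see. *)
Let V0 (h : C -> C) : Prop := analytic h /\ h 0%C = 0%C /\ vanishes p (jet b h).

(** Continuity of the evaluation at one point, by [Hloc] and Cauchy's estimate if a derivative is
    evaluated. [L] depends on [z]; the gliding hump uses it to choose the later terms so small that
    they cannot disturb the value reached at [z]. *)
Lemma functional_bounded (z : C) : inD z -> exists L, 0 <= L /\ forall h N,
  analytic h -> h 0%C = 0%C -> bounded_by p (jet b h) N -> wt q z * Cmod (jet b' h z) <= L * N.
Proof.
  intros Hz. unfold inD in Hz. set (r := (1 - Cmod z) / 2).
  assert (Hr : 0 < r) by (unfold r; lra).
  destruct (Hloc (Cmod z + r)) as (L & PL & HL). unfold r; lra.
  assert (Pq := wt_ge_0 q z Hq Hz).
  destruct b' eqn:Eb.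
  - exists (wt q z * (2 * L / r)). split.
    { apply Rmult_le_pos; trivial. apply Rmult_le_pos. lra. left; now apply Rinv_0_lt_compat. }
    intros h N Hh H0 HN. rewrite Rmult_assoc. apply Rmult_le_compat_l; trivial. simpl.
    replace (2 * L / r * N) with (2 * (L * N) / r) by (field; lra).
    apply Cderiv_bound; trivial. apply analytic_diffon; trivial. unfold r; lra.
    intros w Hw. apply HL; trivial. assert (T := Cmod_le_sub w z). lra.
  - exists (wt q z * L). split. now apply Rmult_le_pos.
    intros h N Hh H0 HN. rewrite Rmult_assoc. apply Rmult_le_compat_l; trivial.
    apply HL; trivial. lra.
Qed.

(** The dilation [h (r w)] with [r < 1] has a bounded jet, so the typical weight [p] makes it vanish
    at the boundary; monotonicity of [p] keeps its seminorm at most [N]; and a strict inequality at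
    [z] survives for [r] close to 1. *)
Lemma dilation_approx (h : C -> C) (N M : R) (z : C) :
  analytic h -> h 0%C = 0%C -> bounded_by p (jet b h) N -> inD z ->
  M < wt q z * Cmod (jet b' h z) ->
  exists h', V0 h' /\ bounded_by p (jet b h') N /\ M < wt q z * Cmod (jet b' h' z).
Proof.
  intros Hh H0 HN Hz HM. set (X := Cmod (jet b' h z)) in *.
  assert (Pq := wt_ge_0 q z Hq Hz).
  destruct (small_factor ((wt q z * X - M) / 2) (wt q z)) as (e & He & _ & He2); try lra.
  assert (exists r, 0 <= r < 1 /\ X - e <= Cmod (jet b' (fun w => h (RtoC r * w)%C) z)) as (r & Hr & HX).
  (* The jet of the dilation at [z], as a function of the dilation factor [s], is differentiable at
     [s = 1]; only its continuity is used. *)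
  { assert (Hu : cdiff (fun s => (if b' then s else 1) * jet b' h (s * z))%C 1
       ((if b' then 1 else 0) * jet b' h (1 * z) + (if b' then 1 else 1) * (Cderiv (jet b' h) (1 * z) * z))%C).
    { apply (cdiff_mult (fun s => if b' then s else 1%C) (fun s => jet b' h (s * z))%C).
      - destruct b'. apply cdiff_id. apply cdiff_const.
      - apply (cdiff_line (jet b' h)). apply analytic_cdiff. now apply jet_analytic.
        now replace (1 * z)%C with z by ring. }
    destruct (cdiff_cont _ _ _ Hu e He) as (d & Hd & K).
    set (t := Rmin 1 (d / 2)). assert (Ht : 0 < t) by (apply Rmin_pos; lra).
    assert (Q1 := Rmin_l 1 (d / 2)). assert (Q2 := Rmin_r 1 (d / 2)). fold t in Q1, Q2.
    exists (1 - t). split. lra.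
    rewrite jet_dilate by (trivial; lra).
    specialize (K (RtoC (- t))). rewrite Cmod_R, Rabs_Ropp, Rabs_pos_eq in K by lra.
    specialize (K ltac:(lra)).
    replace (1 + RtoC (- t))%C with (RtoC (1 - t)) in K by (rewrite RtoC_minus, RtoC_opp; ring).
    replace (1 * z)%C with z in K by ring.
    assert (T := Cmod_le_sub (jet b' h z) ((if b' then RtoC (1 - t) else 1) * jet b' h (RtoC (1 - t) * z))%C).
    rewrite Cmod_sub_swap in T. fold X in T.
    replace ((if b' then 1 else 1) * jet b' h z)%C with (jet b' h z) in K by (destruct b'; ring).
    lra. }
  exists (fun w => h (RtoC r * w)%C). split; [split; [|split]|split].
  - apply analytic_dilate; trivial. lra.
  - now replace (RtoC r * 0)%C with (RtoC 0) by ring.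
  - destruct (analytic_bounded (jet b h) r) as [B HB]. now apply jet_analytic. lra.
    intros eps Heps. destruct (small_factor (eps / 2) (Rmax 0 B)) as (a & Ha & _ & Ha2); try lra.
    apply Rmax_l. destruct (Htyp a Ha) as (d & Hd & K). exists d. split; trivial.
    intros w Hw Hdw. rewrite jet_dilate by (trivial; lra). rewrite Cmod_mult.
    specialize (K w Hw Hdw). assert (Pw := wt_ge_0 p w Hp Hw).
    assert (Cmod (if b then RtoC r else 1) <= 1).
    { destruct b; rewrite Cmod_R, Rabs_pos_eq; lra. }
    assert (Cmod (jet b h (RtoC r * w)%C) <= Rmax 0 B).
    { eapply Rle_trans; [|apply Rmax_r]. apply HB. rewrite Cmod_mult, Cmod_R, Rabs_pos_eq by lra.
      unfold inD in Hw. nra. }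
    assert (P1 := Cmod_ge_0 (if b then RtoC r else 1)%C). assert (P2 := Cmod_ge_0 (jet b h (RtoC r * w)%C)).
    assert (Cmod (if b then RtoC r else 1) * Cmod (jet b h (RtoC r * w)%C) <= 1 * Rmax 0 B)
      by (apply Rmult_le_compat; lra).
    assert (wt p w * (Cmod (if b then RtoC r else 1) * Cmod (jet b h (RtoC r * w)%C)) <= a * (1 * Rmax 0 B)).
    { apply Rmult_le_compat; try lra. now apply Rmult_le_pos. }
    lra.
  - intros w Hw. rewrite jet_dilate by (trivial; lra).
    assert (Hrw : inD (RtoC r * w)) by (apply inD_segment; trivial; lra).
    specialize (HN _ Hrw). eapply Rle_trans; [|exact HN].
    rewrite Cmod_mult.
    assert (Cmod (if b then RtoC r else 1) <= 1).
    { destruct b; rewrite Cmod_R, Rabs_pos_eq; lra. }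
    assert (P2 := Cmod_ge_0 (jet b h (RtoC r * w)%C)).
    apply Rmult_le_compat. now apply wt_ge_0. apply Rmult_le_pos; trivial. apply Cmod_ge_0.
    + apply wt_le; trivial. apply Cmod_segment. lra.
    + nra.
  - apply Rlt_le_trans with (wt q z * (X - e)); [lra|]. now apply Rmult_le_compat_l.
Qed.

(** Completeness of [V0] with the rate of convergence: [Hloc] makes the sequence locally uniformly
    Cauchy, the jets converge pointwise by the limit theorem, and the seminorm estimates hold in the
    limit [m] to infinity. *)
Lemma pnorm_complete (s : nat -> C -> C) (eta : nat -> R) :
  (forall n, V0 (s n)) -> (forall eps, 0 < eps -> exists n, eta n <= eps) ->
  (forall n m, (n <= m)%nat -> bounded_by p (jet b (fun w => s m w + - (1) * s n w)%C) (eta n)) ->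
  exists l, V0 l /\ forall n, bounded_by p (jet b (fun w => l w + - (1) * s n w)%C) (eta n).
Proof.
  intros Hs Heta Hb.
  assert (Peta : forall n, 0 <= eta n).
  { intros n. eapply Rle_trans; [|apply (Hb n n (Nat.le_refl n) 0 inD_0)].
    apply Rmult_le_pos. now apply wt_ge_0, inD_0. apply Cmod_ge_0. }
  assert (Hunif : forall rho, rho < 1 -> exists L, 0 <= L /\ forall n m z, (n <= m)%nat -> Cmod z <= rho ->
    Cmod (s m z - s n z) <= L * eta n).
  { intros rho Hrho. destruct (Hloc rho Hrho) as (L & PL & HL). exists L. split; trivial.
    intros n m z Hnm Hz. replace (s m z - s n z)%C with (s m z + - (1) * s n z)%C by ring.
    apply (HL (fun w => s m w + - (1) * s n w)%C); trivial.
    - apply analytic_lin; apply Hs.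
    - destruct (Hs n) as (_ & -> & _). destruct (Hs m) as (_ & -> & _). ring.
    - now apply Hb. }
  assert (Hsmall : forall L, 0 <= L -> forall eps, 0 < eps -> exists n, L * eta n <= eps).
  { intros L PL eps He. destruct (small_factor eps L) as (a & Ha & _ & Ha2); trivial.
    destruct (Heta a Ha) as [n Hn]. exists n. nra. }
  set (l := fun z => epsilon (inhabits (RtoC 0)) (Cconv (fun n => s n z))).
  assert (Hl : forall z, inD z -> Cconv (fun n => s n z) (l z)).
  { intros z Hz. apply epsilon_spec. apply Cconv_cauchy. intros eps He.
    destruct (Hunif (Cmod z) Hz) as (L & PL & HL).
    destruct (Hsmall L PL eps He) as [N HN]. exists N. intros n Hn.
    eapply Rle_trans; [|exact HN]. apply HL; trivial. lra. }
  assert (Hd : forall z, inD z -> exists d, cdiff l z d /\ Cconv (fun n => Cderiv (s n) z) d).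
  { intros z Hz. unfold inD in Hz. set (r := (1 - Cmod z) / 2).
    assert (Hr : 0 < r) by (unfold r; lra).
    destruct (Hunif (Cmod z + r)) as (L & PL & HL). unfold r; lra.
    assert (In : forall w, Cmod (w - z) < r -> Cmod w <= Cmod z + r).
    { intros w Hw. assert (T := Cmod_le_sub w z). lra. }
    apply (cdiff_uniform_limit s l z r (fun n => L * eta n)); trivial.
    - intros n. apply analytic_diffon. apply Hs. unfold r; lra.
    - intros n m w Hnm Hw. apply HL; trivial. now apply In.
    - intros eps He. now apply Hsmall.
    - intros w Hw. apply Hl. unfold inD. specialize (In w Hw). unfold r in In. lra. }
  assert (Al : analytic l).
  { intros z Hz. destruct (Hd z Hz) as (d & Hd1 & _). exists d. now apply is_derive_cdiff. }
  assert (Hj : forall z, inD z -> Cconv (fun n => jet b (s n) z) (jet b l z)).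
  { intros z Hz. destruct b; simpl; [|now apply Hl].
    destruct (Hd z Hz) as (d & Hd1 & Hd2). now rewrite (Cderiv_eq _ _ _ Hd1). }
  assert (Hlb : forall n, bounded_by p (jet b (fun w => l w + - (1) * s n w)%C) (eta n)).
  { intros n z Hz. assert (Pz := wt_ge_0 p z Hp Hz).
    rewrite jet_lin; trivial; [|apply Hs].
    rewrite <- (Rabs_pos_eq _ Pz), <- Cmod_R, <- Cmod_mult.
    apply Cconv_Cmod_le with (s := fun m => (RtoC (wt p z) * (jet b (s m) z + - (1) * jet b (s n) z))%C) (N := n).
    - apply Cconv_scal. apply Cconv_plus. now apply Hj. apply Cconv_const.
    - intros m Hm. rewrite Cmod_mult, Cmod_R, (Rabs_pos_eq _ Pz).
      specialize (Hb n m Hm z Hz). rewrite jet_lin in Hb; trivial; apply Hs. }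
  exists l. split; trivial. split; [|split]; trivial.
  - assert (T : Cmod (l 0%C) <= 0).
    { apply Cconv_Cmod_le with (s := fun n => s n 0%C) (N := O). apply Hl, inD_0.
      intros n _. destruct (Hs n) as (_ & -> & _). rewrite Cmod_0. lra. }
    apply Cmod_eq_0. generalize (Cmod_ge_0 (l 0%C)). lra.
  - intros eps He. destruct (Heta (eps / 2)) as [n Hn]. lra.
    destruct (Hs n) as (An & _ & Vn). destruct (Vn (eps / 2)) as (d & Hd' & K). lra.
    exists d. split; trivial. intros z Hz Hdz. specialize (K z Hz Hdz).
    specialize (Hlb n z Hz). rewrite jet_lin in Hlb; trivial.
    assert (Pz := wt_ge_0 p z Hp Hz).
    assert (T := Cmod_le_sub (jet b l z) (jet b (s n) z)).
    replace (jet b l z - jet b (s n) z)%C with (jet b l z + - (1) * jet b (s n) z)%C in T by ring.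
    apply Rle_lt_trans with (wt p z * (Cmod (jet b (s n) z) + Cmod (jet b l z + - (1) * jet b (s n) z))).
    now apply Rmult_le_compat_l. lra.
Qed.

(* Gliding hump: if no uniform constant existed, suitably signed partial sums of ever smaller
   functions would converge to some [l] in [V0] on which the [q]-seminorm is infinite. *)
Lemma uniform_bound :
  (forall h, V0 h -> exists M, bounded_by q (jet b' h) M) ->
  exists K, 0 <= K /\ forall h N, analytic h -> h 0%C = 0%C -> bounded_by p (jet b h) N ->
    bounded_by q (jet b' h) (K * N).
Proof.
  intros Hqual. apply NNPP. intros Hno.
  (* Failure of every constant gives arbitrarily large values at a cost [delta]; dilation then moves
     the witness into [V0]. *)
  assert (bump : forall delta M, 0 < delta -> exists h z, V0 h /\ bounded_by p (jet b h) delta /\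
    inD z /\ M < wt q z * Cmod (jet b' h z)).
  { intros delta M Hdel. apply NNPP. intros Hc. apply Hno.
    set (M' := Rabs M + 1). assert (PM : 0 < M') by (unfold M'; generalize (Rabs_pos M); lra).
    exists (M' / delta). split. { left. now apply Rdiv_lt_0_compat. }
    intros h N Hh H0 HN z Hz. apply Rnot_lt_le. intros Hlt. apply Hc.
    set (x := wt q z * Cmod (jet b' h z)) in *.
    assert (PN : 0 <= N).
    { eapply Rle_trans; [|apply (HN 0 inD_0)].
      apply Rmult_le_pos. now apply wt_ge_0, inD_0. apply Cmod_ge_0. }
    assert (Pd : 0 < M' / delta) by now apply Rdiv_lt_0_compat.
    assert (Px : 0 < x) by (assert (0 <= M' / delta * N) by (apply Rmult_le_pos; lra); lra).
    (* This scaling makes the value at [z] exactly [M'], which exceeds [M]; since [x] is more than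
       [M' / delta * N], the seminorm falls below [delta]. *)
    set (c := M' / x). assert (Pc : 0 < c) by now apply Rdiv_lt_0_compat.
    assert (HcN : c * N <= delta).
    { apply Rmult_le_reg_r with (x / delta). now apply Rdiv_lt_0_compat.
      unfold c. replace (M' / x * N * (x / delta)) with (M' / delta * N) by (field; lra).
      replace (delta * (x / delta)) with x by (field; lra). lra. }
    assert (A0 : analytic (fun _ : C => RtoC 0)).
    { apply cdiff_analytic with (fun _ => RtoC 0). intros w _. apply cdiff_const. }
    assert (J0 : forall bb w, jet bb (fun _ : C => RtoC 0) w = 0%C).
    { intros bb w. destruct bb; simpl; trivial. apply Cderiv_eq, cdiff_const. }
    assert (J : forall bb w, inD w -> Cmod (jet bb (fun w => 0 + RtoC c * h w)%C w) = c * Cmod (jet bb h w)).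
    { intros bb w Hw. rewrite (jet_lin bb (RtoC c) (fun _ => RtoC 0)); trivial. rewrite J0, Cplus_0_l, Cmod_mult, Cmod_R, Rabs_pos_eq; lra. }
    destruct (dilation_approx (fun w => 0 + RtoC c * h w)%C delta M z) as (h' & V' & B' & K').
    - now apply (analytic_lin (RtoC c) (fun _ => RtoC 0)).
    - rewrite H0. ring.
    - intros w Hw. rewrite J by trivial. specialize (HN w Hw).
      replace (wt p w * (c * Cmod (jet b h w))) with (c * (wt p w * Cmod (jet b h w))) by ring. nra.
    - trivial.
    - rewrite J by trivial. replace (wt q z * (c * Cmod (jet b' h z))) with (c * x) by (unfold x; ring).
      unfold c. replace (M' / x * x) with M' by (field; lra).
      unfold M'. generalize (Rle_abs M). lra.
    - now exists h', z. }
  (* A state is a partial sum with the tolerance left for what follows. The next sum stays within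
     the old tolerance and is large at some [z]; the new tolerance is at most half the old one, and
     so small that a change of seminorm at most twice it alters the value at [z] by at most 1. *)
  set (good := fun (n : nat) (s t : (C -> C) * R) =>
    V0 (fst t) /\ 0 < snd t <= snd s / 2 /\
    bounded_by p (jet b (fun w => fst t w + - (1) * fst s w)%C) (snd s) /\
    exists z, inD z /\ INR n + 1 < wt q z * Cmod (jet b' (fst t) z) /\
      forall h, analytic h -> h 0%C = 0%C -> bounded_by p (jet b h) (2 * snd t) ->
        wt q z * Cmod (jet b' h z) <= 1).
  assert (Hex : forall n s, V0 (fst s) -> 0 < snd s -> exists t, good n s t).
  { intros n [s eta] Hs Heta. simpl in Hs, Heta.
    destruct (bump eta (INR n + 1) Heta) as (h & z & (Ah & H0 & Vh) & Bh & Hz & Hbig).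
    destruct Hs as (As & S0 & Vs).
    destruct (functional_bounded z Hz) as (L & PL & HL).
    destruct (small_factor 1 (2 * L)) as (a & Ha & _ & Ha2); try lra.
    assert (Pqz := wt_ge_0 q z Hq Hz).
    (* Since [2 |y| <= |x + y| + |x - y|], one of the two signs keeps the sum large, whatever the
       value [x] accumulated so far. *)
    assert (exists c, Cmod c = 1 /\ INR n + 1 < wt q z * Cmod (jet b' s z + c * jet b' h z)) as (c & Hc & Hcb).
    { set (x := jet b' s z) in *. set (y := jet b' h z) in *.
      destruct (Rlt_dec (INR n + 1) (wt q z * Cmod (x + 1 * y))) as [Hl|Hl].
      - exists 1%C. split; trivial. apply Cmod_1.
      - exists (- (1))%C. split. apply Cmod_m1.
        assert (T : 2 * Cmod y <= Cmod (x + 1 * y) + Cmod (x + - (1) * y)).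
        { replace (2 * Cmod y) with (Cmod (2 * y)%C).
          2:{ rewrite Cmod_mult, Cmod_R, Rabs_pos_eq; lra. }
          replace (2 * y)%C with ((x + 1 * y) - (x + - (1) * y))%C by ring.
          eapply Rle_trans. apply Cmod_triangle. rewrite Cmod_opp. lra. }
        apply Rmult_le_compat_l with (r := wt q z) in T; trivial. lra. }
    set (t := fun w => (s w + c * h w)%C).
    assert (At : analytic t) by now apply analytic_lin.
    exists (t, Rmin (eta / 2) a).
    assert (Q1 := Rmin_l (eta / 2) a). assert (Q2 := Rmin_r (eta / 2) a).
    assert (Pm : 0 < Rmin (eta / 2) a) by (apply Rmin_pos; lra).
    split; [|split; [|split]]; simpl.
    - split; trivial. split. { unfold t. rewrite S0, H0. ring. }
      intros eps He. destruct (Vs (eps / 2)) as (d1 & Hd1 & K1). lra.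
      destruct (Vh (eps / 2)) as (d2 & Hd2 & K2). lra.
      exists (Rmax d1 d2). split. now apply Rmax_lub_lt. intros w Hw Hdw.
      assert (T1 := Rmax_l d1 d2). assert (T2 := Rmax_r d1 d2).
      specialize (K1 w Hw ltac:(lra)). specialize (K2 w Hw ltac:(lra)).
      unfold t. rewrite jet_lin by trivial. assert (Pw := wt_ge_0 p w Hp Hw).
      apply Rle_lt_trans with (wt p w * (Cmod (jet b s w) + Cmod (jet b h w))); [|lra].
      apply Rmult_le_compat_l; trivial. eapply Rle_trans. apply Cmod_triangle.
      rewrite Cmod_mult, Hc. lra.
    - split; trivial.
    - intros w Hw. rewrite jet_lin by trivial. unfold t. rewrite jet_lin by trivial.
      replace (jet b s w + c * jet b h w + - (1) * jet b s w)%C with (c * jet b h w)%C by ring.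
      rewrite Cmod_mult, Hc, Rmult_1_l. now apply Bh.
    - exists z. split; trivial. split.
      + unfold t. now rewrite jet_lin by trivial.
      + intros k Ak K0 Bk. eapply Rle_trans. now apply (HL k _ Ak K0 Bk). nra. }
  set (start := ((fun _ : C => RtoC 0), 1)).
  set (seq := fix seq n := match n with O => start
    | S m => epsilon (inhabits start) (good m (seq m)) end).
  assert (Hinv : forall n, V0 (fst (seq n)) /\ 0 < snd (seq n)).
  { induction n.
    - simpl. split; [|lra]. split; [|split]; trivial.
      + apply cdiff_analytic with (fun _ => RtoC 0). intros; apply cdiff_const.
      + intros eps He. exists 0. split. lra. intros z Hz _.
        replace (jet b (fun _ : C => RtoC 0) z) with (RtoC 0).
        * rewrite Cmod_0. lra.
        * destruct b; simpl; trivial. symmetry. apply Cderiv_eq, cdiff_const.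
    - destruct IHn as [I1 I2].
      destruct (epsilon_spec (inhabits start) (good n (seq n)) (Hex n _ I1 I2)) as (G1 & G2 & _).
      split. exact G1. apply G2. }
  assert (Hstep : forall n, good n (seq n) (seq (S n))).
  { intros n. destruct (Hinv n) as [I1 I2].
    exact (epsilon_spec (inhabits start) (good n (seq n)) (Hex n _ I1 I2)). }
  set (s := fun n => fst (seq n)). set (eta := fun n => snd (seq n)).
  assert (Peta : forall n, 0 < eta n) by (intros n; apply Hinv).
  assert (Heta : forall n, eta n <= (1 / 2) ^ n).
  { induction n. unfold eta; simpl; lra.
    destruct (Hstep n) as (_ & G & _). fold (eta n) in G. fold (eta (S n)) in G. simpl. lra. }
  destruct (pnorm_complete s (fun n => 2 * eta n)) as (l & Vl & Hl).
  - intros n. apply Hinv.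
  - intros eps He. destruct (pow_lt_1_zero (1 / 2)) with (y := eps / 2) as [N HN].
    rewrite Rabs_pos_eq; lra. lra. exists N. specialize (HN N (Nat.le_refl N)).
    rewrite Rabs_pos_eq in HN by (apply pow_le; lra). specialize (Heta N). lra.
  (* Telescoping: as [eta (n + 1) <= eta n / 2], each step costs at most
     [eta n <= 2 * eta n - 2 * eta (n + 1)]. *)
  - assert (tele : forall n j, bounded_by p (jet b (fun w => s (n + j)%nat w + - (1) * s n w)%C) (2 * eta n - 2 * eta (n + j)%nat)).
    { intros n j. induction j; intros z Hz.
      - rewrite Nat.add_0_r, jet_lin; trivial; try apply Hinv.
        replace (jet b (s n) z + - (1) * jet b (s n) z)%C with (RtoC 0) by ring. rewrite Cmod_0. lra.
      - rewrite Nat.add_succ_r. specialize (IHj z Hz).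
        destruct (Hstep (n + j)%nat) as (_ & G & Bd & _). specialize (Bd z Hz).
        fold (eta (n + j)%nat) in G, Bd. fold (eta (S (n + j))) in G.
        fold (s (n + j)%nat) in Bd. fold (s (S (n + j))) in Bd.
        rewrite jet_lin in IHj, Bd |- *; trivial; try apply Hinv.
        assert (Pz := wt_ge_0 p z Hp Hz).
        apply Rle_trans with (wt p z * (Cmod (jet b (s (S (n + j))) z + - (1) * jet b (s (n + j)%nat) z)
          + Cmod (jet b (s (n + j)%nat) z + - (1) * jet b (s n) z))); [|lra].
        apply Rmult_le_compat_l; trivial.
        replace (jet b (s (S (n + j))) z + - (1) * jet b (s n) z)%C with
          ((jet b (s (S (n + j))) z + - (1) * jet b (s (n + j)%nat) z)
            + (jet b (s (n + j)%nat) z + - (1) * jet b (s n) z))%C by ring.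
        apply Cmod_triangle. }
    intros n m Hnm z Hz. replace m with (n + (m - n))%nat by lia.
    eapply Rle_trans. now apply tele. generalize (Peta (n + (m - n))%nat). lra.
  - destruct (Hqual l Vl) as [M HM].
    (* With [n] above [M], the sum [s (n + 1)] exceeds [n + 1] at its point [z] while [l] differs
       from it by at most 1 there, against the bound [M] for [l]. *)
    destruct (nfloor_ex (Rmax 0 M + 1)) as [n [_ Hn]]. generalize (Rmax_l 0 M); lra.
    destruct (Hstep n) as (_ & _ & _ & z & Hz & Hbig & Hsm).
    fold (s (S n)) in Hbig. specialize (HM z Hz). specialize (Hl (S n)).
    assert (Al : analytic l) by apply Vl.
    assert (As : analytic (s (S n))) by apply Hinv.
    specialize (Hsm (fun w => l w + - (1) * s (S n) w)%C).
    rewrite jet_lin in Hsm by trivial.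
    specialize (Hsm ltac:(now apply analytic_lin)).
    assert (E0 : (l 0 + - (1) * s (S n) 0)%C = 0%C).
    { destruct Vl as (_ & -> & _). destruct (Hinv (S n)) as [(_ & E & _) _]. fold (s (S n)) in E.
      rewrite E. ring. }
    specialize (Hsm E0 Hl).
    assert (Pqz := wt_ge_0 q z Hq Hz).
    assert (T := Cmod_le_sub (jet b' (s (S n)) z) (jet b' l z)). rewrite Cmod_sub_swap in T.
    replace (jet b' l z - jet b' (s (S n)) z)%C with (jet b' l z + - (1) * jet b' (s (S n)) z)%C in T by ring.
    apply Rmult_le_compat_l with (r := wt q z) in T; trivial.
    generalize (Rmax_r 0 M). lra.
Qed.

End UniformBoundedness.

(** * Weights and the operator *)

Lemma weight_profile (nu : R -> R) : weight nu -> decreasing_profile nu.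
Proof. intros (H1 & _ & H3). now split. Qed.

Lemma mu1_profile (mu : R -> R) : decreasing_profile mu -> decreasing_profile (mu1 mu).
Proof.
  intros [H1 H2]. unfold mu1. split.
  - intros r Hr. apply Rmult_le_pos. now apply H1. nra.
  - intros r s Hr Hrs Hs. apply Rmult_le_compat. apply H1; lra. nra. now apply H2. nra.
Qed.

Lemma quasi_normal_typical (mu : R -> R) : quasi_normal mu -> typical mu.
Proof.
  intros H eps He.
  assert (A1 : analytic (fun _ => RtoC 1)).
  { apply cdiff_analytic with (fun _ => RtoC 0). intros; apply cdiff_const. }
  destruct (proj2 (H (fun _ => RtoC 1))) as [_ K].
  { split; trivial. intros e Hee. exists 0. split. lra. intros z _ _.
    rewrite (Cderiv_eq _ _ _ (cdiff_const 1 z)), Cmod_0. lra. }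
  destruct (K eps He) as (d & Hd & Kd). exists d. split; trivial.
  intros z Hz Hdz. specialize (Kd z Hz Hdz). rewrite Cmod_1 in Kd. lra.
Qed.

Lemma mu1_typical (mu : R -> R) : decreasing_profile mu -> typical mu -> typical (mu1 mu).
Proof.
  intros Hp H eps He. destruct (H eps He) as (d & Hd & K). exists d. split; trivial.
  intros z Hz Hdz. specialize (K z Hz Hdz). eapply Rle_lt_trans; [|exact K].
  assert (P := wt_ge_0 mu z Hp Hz). unfold wt, mu1 in *. assert (Pz := Cmod_ge_0 z). nra.
Qed.

Lemma bound_by_derivative (h : C -> C) (z : C) (M : R) : analytic h -> h 0%C = 0%C -> inD z ->
  (forall w, Cmod w <= Cmod z -> Cmod (Cderiv h w) <= M) -> Cmod (h z) <= M * Cmod z.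
Proof.
  intros Hh H0 Hz HM.
  replace (h z) with (h (0 + z)%C - h 0%C)%C by (rewrite H0, Cplus_0_l; ring).
  apply mean_value_inequality. intros t Ht. rewrite Cplus_0_l. split.
  - apply analytic_cdiff; trivial. now apply inD_segment.
  - apply HM. now apply Cmod_segment.
Qed.

Lemma bound_div (x a N : R) : 0 < a -> a * x <= N -> x <= / a * N.
Proof.
  intros Ha H. apply Rmult_le_reg_l with a; trivial.
  rewrite <- Rmult_assoc, Rinv_r by lra. lra.
Qed.

(** * Quasi-normality as norm inequalities *)

Section QuasiNormal.

Context (mu : R -> R) (Hmu : weight mu) (Hqn : quasi_normal mu).

Let Pmu : decreasing_profile mu := weight_profile mu Hmu.
Let Pmu1 : decreasing_profile (mu1 mu) := mu1_profile mu Pmu.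

(** The qualitative input is the inclusion of the little Bloch space in [H^0_mu]. Local control
    comes from [mu1 mu] being at least [mu1 mu c > 0] on the disc of radius [c]: this bounds [h'],
    and then [h] because [h 0 = 0]. *)
Lemma derivative_to_value_pos : (forall r, 0 <= r < 1 -> 0 < mu r) ->
  exists K, 0 <= K /\ forall h N, analytic h -> h 0%C = 0%C ->
    bounded_by (mu1 mu) (Cderiv h) N -> bounded_by mu h (K * N).
Proof.
  intros Hpos.
  apply (uniform_bound true false (mu1 mu) mu Pmu1
    (mu1_typical _ Pmu (quasi_normal_typical _ Hqn)) Pmu).
  - intros rho Hrho. set (c := Rmax 0 rho).
    assert (Hc : 0 <= c < 1) by (split; [apply Rmax_l | apply Rmax_lub_lt; lra]).
    assert (Pc : 0 < mu1 mu c).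
    { unfold mu1. apply Rmult_lt_0_compat. now apply Hpos. nra. }
    exists (/ mu1 mu c). split. { left. now apply Rinv_0_lt_compat. }
    intros h N Hh H0 HN z Hz.
    assert (Hzc : Cmod z <= c) by (eapply Rle_trans; [exact Hz | apply Rmax_r]).
    assert (Hzd : inD z) by (unfold inD; lra).
    assert (PN : 0 <= / mu1 mu c * N).
    { apply Rmult_le_pos. left. now apply Rinv_0_lt_compat.
      eapply Rle_trans; [|apply (HN 0%C inD_0)].
      apply Rmult_le_pos. now apply wt_ge_0, inD_0. apply Cmod_ge_0. }
    apply Rle_trans with (/ mu1 mu c * N * Cmod z).
    + apply bound_by_derivative; trivial. intros w Hw. apply bound_div; trivial.
      assert (Hwd : inD w) by (unfold inD in *; lra).
      eapply Rle_trans; [|apply (HN w Hwd)]. apply Rmult_le_compat_r. apply Cmod_ge_0.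
      apply Pmu1; try apply Cmod_ge_0; lra.
    + unfold inD in Hzd. nra.
  - intros h (Ah & _ & Vh). apply vanishes_bounded; trivial. exact (proj2 (proj2 (Hqn h) (conj Ah Vh))).
Qed.

(** If [mu] vanishes from [r] on, the inequality is elementary: a point [z] with positive weight has
    [|z| < r], and on the segment from 0 to [z] the weight is at least [mu z] and [1 - |w|^2] at
    least [1 - r^2]. *)
Lemma derivative_to_value : exists K, 0 <= K /\ forall h N, analytic h -> h 0%C = 0%C ->
    bounded_by (mu1 mu) (Cderiv h) N -> bounded_by mu h (K * N).
Proof.
  destruct (classic (exists r, 0 <= r < 1 /\ mu r <= 0)) as [(r & Hr & Hr0)|Hno].
  2:{ apply derivative_to_value_pos. intros r Hr. apply Rnot_le_lt. intros Hc. apply Hno. now exists r. }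
  assert (Pr : 0 < 1 - r ^ 2) by nra.
  exists (/ (1 - r ^ 2)). split. { left. now apply Rinv_0_lt_compat. }
  intros h N Hh H0 HN z Hz.
  assert (PN : 0 <= / (1 - r ^ 2) * N).
  { apply Rmult_le_pos. left. now apply Rinv_0_lt_compat.
    eapply Rle_trans; [|apply (HN 0%C inD_0)].
    apply Rmult_le_pos. now apply wt_ge_0, inD_0. apply Cmod_ge_0. }
  assert (Pz := wt_ge_0 mu z Pmu Hz). assert (Cz := Cmod_ge_0 z).
  destruct (Rle_lt_dec (wt mu z) 0) as [Hz0|Hz0].
  { replace (wt mu z) with 0 by lra. now rewrite Rmult_0_l. }
  assert (Hzr : Cmod z < r).
  { apply Rnot_le_lt. intros Hc. assert (T := proj2 Pmu r (Cmod z) ltac:(lra) Hc Hz).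
    unfold wt in Hz0. lra. }
  set (M := / (1 - r ^ 2) * N). fold M in PN.
  assert (B : Cmod (h z) <= / wt mu z * M * Cmod z).
  { apply bound_by_derivative; trivial. intros w Hw.
    assert (Hwd : inD w) by (unfold inD in *; lra).
    apply bound_div; trivial. apply bound_div; trivial.
    eapply Rle_trans; [|apply (HN w Hwd)].
    rewrite <- Rmult_assoc. apply Rmult_le_compat_r. apply Cmod_ge_0.
    assert (T := wt_le mu z w Pmu Hz Hw). assert (Cw := Cmod_ge_0 w).
    unfold wt, mu1 in *. rewrite Rmult_comm. apply Rmult_le_compat; try lra. nra. }
  apply Rmult_le_compat_l with (r := wt mu z) in B; trivial.
  eapply Rle_trans; [exact B|].
  replace (wt mu z * (/ wt mu z * M * Cmod z)) with (M * Cmod z) by (field; lra).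
  unfold inD in Hz. nra.
Qed.

(** The opposite inclusion supplies the qualitative input, and local control of [h] is immediate
    from the lower bound [mu c > 0]. *)
Lemma value_to_derivative_pos : (forall r, 0 <= r < 1 -> 0 < mu r) ->
  exists K, 0 <= K /\ forall h N, analytic h -> h 0%C = 0%C ->
    bounded_by mu h N -> bounded_by (mu1 mu) (Cderiv h) (K * N).
Proof.
  intros Hpos.
  apply (uniform_bound false true mu (mu1 mu) Pmu (quasi_normal_typical _ Hqn) Pmu1).
  - intros rho Hrho. set (c := Rmax 0 rho).
    assert (Hc : 0 <= c < 1) by (split; [apply Rmax_l | apply Rmax_lub_lt; lra]).
    assert (Pc := Hpos c Hc).
    exists (/ mu c). split. { left. now apply Rinv_0_lt_compat. }
    intros h N Hh H0 HN z Hz.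
    assert (Hzc : Cmod z <= c) by (eapply Rle_trans; [exact Hz | apply Rmax_r]).
    assert (Hzd : inD z) by (unfold inD; lra).
    apply bound_div; trivial. eapply Rle_trans; [|apply (HN z Hzd)].
    apply Rmult_le_compat_r. apply Cmod_ge_0. apply Pmu; try apply Cmod_ge_0; lra.
  - intros h (Ah & _ & Vh). apply vanishes_bounded; trivial. now apply Cderiv_analytic. exact (proj2 (proj1 (Hqn h) (conj Ah Vh))).
Qed.

End QuasiNormal.

(** * Property (U) and the derivative *)

(** Property (U) limits the drop of [nu] between radii at comparable distances from the circle. The
    ratio 4 is the one met on the disc of radius [(1 - |z|) / 2] about [z]; the summand 1 in the
    constant covers [s <= r], where monotonicity suffices. *)
Lemma propU_comparable (nu : R -> R) : weight nu -> propU nu -> exists K, 0 < K /\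
  forall r s, 0 <= r < 1 -> 0 <= s < 1 -> 1 - r ^ 2 <= 4 * (1 - s ^ 2) -> nu r <= K * nu s.
Proof.
  intros Hnu (al & Hal & K & HK & HU).
  assert (P4 : 0 < Rpower 4 al) by apply exp_pos.
  assert (PK : 0 < K * Rpower 4 al) by now apply Rmult_lt_0_compat.
  exists (1 + K * Rpower 4 al). split. lra.
  intros r s Hr Hs H. assert (Ps : 0 <= nu s) by now apply Hnu.
  destruct (Rle_lt_dec s r) as [Hsr|Hsr].
  - assert (nu r <= nu s) by (apply Hnu; lra). nra.
  - specialize (HU r s ltac:(lra) ltac:(lra) ltac:(lra)).
    assert (Pr : 0 < 1 - r ^ 2) by nra. assert (Pss : 0 < 1 - s ^ 2) by nra.
    assert (Q : Rpower (1 - r ^ 2) al <= Rpower 4 al * Rpower (1 - s ^ 2) al).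
    { rewrite Rpower_mult_distr by lra. apply Rle_Rpower_l; lra. }
    assert (R1 : 0 < Rpower (1 - r ^ 2) al) by apply exp_pos.
    assert (R2 : 0 < Rpower (1 - s ^ 2) al) by apply exp_pos.
    apply Rmult_le_compat_r with (r := Rpower (1 - r ^ 2) al) in HU; [|lra].
    unfold Rdiv at 1 in HU. rewrite Rmult_assoc, Rinv_l, Rmult_1_r in HU by lra.
    eapply Rle_trans; [exact HU|].
    apply Rle_trans with (K * (nu s / Rpower (1 - s ^ 2) al) * (Rpower 4 al * Rpower (1 - s ^ 2) al)).
    + apply Rmult_le_compat_l; trivial. apply Rmult_le_pos. lra.
      apply Rmult_le_pos; trivial. left. now apply Rinv_0_lt_compat.
    + replace (K * (nu s / Rpower (1 - s ^ 2) al) * (Rpower 4 al * Rpower (1 - s ^ 2) al))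
        with (K * Rpower 4 al * nu s) by (field; lra). nra.
Qed.

(** Cauchy's estimate on a disc where [nu w] is at least a fixed multiple of [nu z]. The bound [N]
    is local, so the lemma serves both for norms and for vanishing at the boundary; 8 bounds
    [4 * (1 + Cmod z)]. *)
Lemma propU_derivative (nu : R -> R) : weight nu -> propU nu -> exists K, 0 < K /\
  forall f z N, analytic f -> inD z ->
    (forall w, Cmod (w - z) < (1 - Cmod z) / 2 -> wt nu w * Cmod (f w) <= N) ->
    wt nu z * (1 - Cmod z ^ 2) * Cmod (Cderiv f z) <= K * N.
Proof.
  intros Hnu HU. destruct (propU_comparable nu Hnu HU) as (K & HK & HKc).
  exists (8 * K). split. lra. intros f z N Hf Hz HN. unfold inD in Hz.
  assert (Cz := Cmod_ge_0 z). set (r := (1 - Cmod z) / 2) in *. assert (Hr : 0 < r) by (unfold r; lra).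
  assert (Pz := wt_ge_0 nu z (weight_profile _ Hnu) Hz).
  assert (PN : 0 <= N).
  { eapply Rle_trans; [|apply (HN z)].
    - apply Rmult_le_pos; trivial. apply Cmod_ge_0.
    - replace (z - z)%C with (RtoC 0) by ring. now rewrite Cmod_0. }
  destruct (Req_dec (wt nu z) 0) as [->|Hn].
  { rewrite !Rmult_0_l. nra. }
  assert (B : Cmod (Cderiv f z) <= 2 * (/ wt nu z * (K * N)) / r).
  { apply Cderiv_bound; trivial. apply analytic_diffon; trivial. unfold r; lra.
    intros w Hw. apply bound_div; [lra|].
    assert (T := Cmod_le_sub w z). assert (Cw := Cmod_ge_0 w).
    apply Rle_trans with (K * (wt nu w * Cmod (f w))).
    - rewrite <- Rmult_assoc. apply Rmult_le_compat_r. apply Cmod_ge_0.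
      apply HKc; try (unfold r in *; lra). unfold r in *. nra.
    - apply Rmult_le_compat_l. lra. now apply HN. }
  apply Rmult_le_compat_l with (r := wt nu z * (1 - Cmod z ^ 2)) in B.
  2:{ apply Rmult_le_pos; trivial. nra. }
  eapply Rle_trans; [exact B|].
  replace (wt nu z * (1 - Cmod z ^ 2) * (2 * (/ wt nu z * (K * N)) / r))
    with (4 * (1 + Cmod z) * (K * N)) by (unfold r; field; lra).
  assert (0 <= K * N) by nra. nra.
Qed.

(** * The test functions *)

(** The factor [z - a] vanishes at [a], so the derivative there is the value of the second factor.
    With the last inverse it forms a Moebius map of modulus at most 1, and the power alone governs
    the size. *)
Definition test_fun (n : nat) (a z : C) : C :=
  ((z - a) * (((1 - Cmod a ^ 2)%R / (1 - Cconj a * z)) ^ n * / (1 - Cconj a * z)))%C.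

Lemma moebius_denominator (a z : C) : inD a -> inD z ->
  (1 - Cmod a) <= Cmod (1 - Cconj a * z) /\ (1 - Cmod z) <= Cmod (1 - Cconj a * z) /\
  Cmod (z - a) <= Cmod (1 - Cconj a * z).
Proof.
  unfold inD. intros Ha Hz. assert (Pa := Cmod_ge_0 a). assert (Pz := Cmod_ge_0 z).
  assert (T := Cmod_le_sub 1 (1 - Cconj a * z)).
  replace (1 - (1 - Cconj a * z))%C with (Cconj a * z)%C in T by ring.
  rewrite Cmod_1, Cmod_mult, Cmod_conj in T.
  split; [nra|split; [nra|]].
  assert (S : forall c : C, Cmod c ^ 2 = fst c * fst c + snd c * snd c).
  { intros c. unfold Cmod. rewrite pow2_sqrt; simpl; nra. }
  apply Rsqr_incr_0_var; [|apply Cmod_ge_0].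
  (* This product equals [|1 - conj a z|^2 - |z - a|^2]. *)
  assert (P : 0 <= (1 - Cmod a ^ 2) * (1 - Cmod z ^ 2)) by (apply Rmult_le_pos; nra).
  rewrite !Rsqr_pow2, !S in *. destruct a as [a1 a2], z as [z1 z2]. simpl in *.
  nra.
Qed.

Lemma cdiff_pow (f : C -> C) (z l : C) (n : nat) : cdiff f z l ->
  exists m, cdiff (fun w => (f w) ^ n)%C z m.
Proof.
  intros H. induction n as [|n [m Hm]].
  - exists 0%C. apply (cdiff_const 1).
  - eexists. apply (cdiff_mult f (fun w => f w ^ n)%C); eauto.
Qed.

Lemma Cmod_pow (c : C) (n : nat) : Cmod (c ^ n) = Cmod c ^ n.
Proof. induction n; simpl. apply Cmod_1. now rewrite Cmod_mult, IHn. Qed.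

Lemma test_factor_cdiff (n : nat) (a z : C) : inD a -> inD z -> exists m,
  cdiff (fun z => ((1 - Cmod a ^ 2)%R / (1 - Cconj a * z)) ^ n * / (1 - Cconj a * z))%C z m.
Proof.
  intros Ha Hz. destruct (moebius_denominator a z Ha Hz) as (H1 & _ & _).
  assert (Hn : (1 - Cconj a * z)%C <> 0%C).
  { intros E. rewrite E, Cmod_0 in H1. unfold inD in Ha. lra. }
  assert (D1 : cdiff (fun z => / (1 - Cconj a * z))%C z
     (- / ((1 - Cconj a * z) * (1 - Cconj a * z)) * (0 - Cconj a * 1))%C).
  { apply (cdiff_comp Cinv (fun z => 1 - Cconj a * z)%C). now apply cdiff_inv.
    apply cdiff_minus. apply cdiff_const. apply cdiff_scal, cdiff_id. }
  destruct (cdiff_pow (fun z => (1 - Cmod a ^ 2)%R * / (1 - Cconj a * z))%C z _ n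
    (cdiff_scal _ _ _ _ D1)) as [m Hm].
  eexists. apply (cdiff_mult _ (fun z => / (1 - Cconj a * z))%C _ _ _ Hm D1).
Qed.

Lemma test_fun_analytic (n : nat) (a : C) : inD a -> analytic (test_fun n a).
Proof.
  intros Ha z Hz. destruct (test_factor_cdiff n a z Ha Hz) as [m Hm].
  eexists. apply is_derive_cdiff. apply (cdiff_mult (fun z => z - a)%C); [|exact Hm].
  apply cdiff_minus. apply cdiff_id. apply cdiff_const.
Qed.

Lemma test_fun_deriv (n : nat) (a : C) : inD a ->
  Cderiv (test_fun n a) a = RtoC (/ (1 - Cmod a ^ 2)).
Proof.
  intros Ha. assert (Pa : 0 < 1 - Cmod a ^ 2).
  { unfold inD in Ha. assert (P := Cmod_ge_0 a). nra. }
  assert (E : (1 - Cconj a * a)%C = RtoC (1 - Cmod a ^ 2)).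
  { rewrite RtoC_minus, Cmod2_conj. ring. }
  assert (Hn : RtoC (1 - Cmod a ^ 2) <> 0%C) by (intros E'; apply RtoC_inj in E'; lra).
  destruct (test_factor_cdiff n a a Ha Ha) as [m D2].
  assert (D3 := cdiff_mult _ _ _ _ _ (cdiff_minus _ _ _ _ _ (cdiff_id a) (cdiff_const a a)) D2).
  apply Cderiv_eq. apply cdiff_val with (1 := D3). cbv beta. rewrite E.
  unfold Cdiv. rewrite Cinv_r by trivial. rewrite Cpow_1_l, RtoC_inv by lra. ring.
Qed.

Lemma test_fun_bound (n : nat) (a z : C) : inD a -> inD z ->
  Cmod (test_fun n a z) <= ((1 - Cmod a ^ 2) / Cmod (1 - Cconj a * z)) ^ n.
Proof.
  intros Ha Hz. destruct (moebius_denominator a z Ha Hz) as (H1 & _ & H3).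
  unfold inD in Ha, Hz. assert (Pa := Cmod_ge_0 a). set (d := Cmod (1 - Cconj a * z)) in *.
  assert (Pd : 0 < d) by lra.
  assert (Hn : (1 - Cconj a * z)%C <> 0%C) by now apply Cmod_gt_0.
  unfold test_fun. rewrite !Cmod_mult, Cmod_pow, Cmod_div, Cmod_inv, Cmod_R by trivial.
  fold d. rewrite Rabs_pos_eq by nra.
  assert (0 <= ((1 - Cmod a ^ 2) / d) ^ n).
  { apply pow_le. apply Rmult_le_pos. nra. left. now apply Rinv_0_lt_compat. }
  replace (Cmod (z - a) * (((1 - Cmod a ^ 2) / d) ^ n * / d)) with
    (Cmod (z - a) / d * ((1 - Cmod a ^ 2) / d) ^ n) by (field; lra).
  rewrite <- (Rmult_1_l (((1 - Cmod a ^ 2) / d) ^ n)) at 2. apply Rmult_le_compat_r; trivial.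
  apply Rmult_le_reg_r with d; trivial. unfold Rdiv. rewrite Rmult_assoc, Rinv_l by lra. lra.
Qed.

Lemma div_pow_le_2 (x d : R) (n : nat) : 0 <= x -> 0 < d -> x <= 2 * d -> (x / d) ^ n <= 2 ^ n.
Proof.
  intros Hx Hd H. apply pow_incr. split.
  - apply Rmult_le_pos; trivial. left. now apply Rinv_0_lt_compat.
  - apply Rmult_le_reg_r with d; trivial. unfold Rdiv. rewrite Rmult_assoc, Rinv_l; lra.
Qed.

Lemma test_fun_le (n : nat) (a z : C) : inD a -> inD z -> Cmod (test_fun n a z) <= 2 ^ n.
Proof.
  intros Ha Hz. eapply Rle_trans. now apply test_fun_bound.
  destruct (moebius_denominator a z Ha Hz) as (H1 & _ & _). unfold inD in Ha.
  assert (Pa := Cmod_ge_0 a). apply div_pow_le_2; nra.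
Qed.

(** For [|a| <= |z|] monotonicity and [|f_a| <= 2^n] suffice. For [|z| < |a|], write [x], [c] for
    [1 - |z|^2], [1 - |a|^2] and [d] for [|1 - conj a z|]: (U) bounds [nu z] by
    [K * nu a * (x / c)^n], where raising the exponent to [n] is allowed as [x / c >= 1]. The factor
    [(c / d)^n] of [f_a] leaves [(x / d)^n <= 2^n]. *)
Lemma test_fun_norm (nu : R -> R) : weight nu -> propU nu -> exists n K, 0 < K /\
  forall a, inD a -> bounded_by nu (test_fun n a) (K * wt nu a).
Proof.
  intros Hnu (al & Hal & K & HK & HU).
  destruct (nfloor_ex al) as [m [_ Hm]]. lra.
  set (n := S m). assert (Hn : al <= INR n) by (unfold n; rewrite S_INR; lra).
  assert (P2 : 0 < 2 ^ n) by (apply pow_lt; lra).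
  exists n, (2 ^ n * (1 + K)). split. apply Rmult_lt_0_compat; lra.
  intros a Ha z Hz. assert (Pnz := wt_ge_0 nu z (weight_profile _ Hnu) Hz).
  assert (Pna := wt_ge_0 nu a (weight_profile _ Hnu) Ha).
  assert (Pz := Cmod_ge_0 z). assert (Pa := Cmod_ge_0 a).
  destruct (Rle_lt_dec (Cmod a) (Cmod z)) as [Haz|Haz].
  - apply Rle_trans with (wt nu a * 2 ^ n).
    + apply Rmult_le_compat; trivial. apply Cmod_ge_0. apply wt_le; trivial. now apply weight_profile.
      now apply test_fun_le.
    + assert (0 <= wt nu a * 2 ^ n) by (apply Rmult_le_pos; lra). nra.
  - destruct (moebius_denominator a z Ha Hz) as (H1 & H2 & _).
    assert (B := test_fun_bound n a z Ha Hz).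
    unfold inD in Ha, Hz. set (d := Cmod (1 - Cconj a * z)) in *. assert (Pd : 0 < d) by lra.
    set (x := 1 - Cmod z ^ 2) in *. set (c := 1 - Cmod a ^ 2) in *.
    assert (Pc : 0 < c) by (unfold c; nra). assert (Pcx : c <= x) by (unfold c, x; nra).
    specialize (HU (Cmod z) (Cmod a) Pz ltac:(lra) Ha). fold x c in HU.
    change (nu (Cmod z)) with (wt nu z) in HU. change (nu (Cmod a)) with (wt nu a) in HU.
    assert (R1 : 0 < Rpower x al) by apply exp_pos. assert (R2 : 0 < Rpower c al) by apply exp_pos.
    assert (Q : Rpower x al <= (x / c) ^ n * Rpower c al).
    { rewrite <- Rpower_pow by (apply Rdiv_lt_0_compat; lra).
      apply Rle_trans with (Rpower (x / c) al * Rpower c al).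
      - rewrite Rpower_mult_distr; [|apply Rdiv_lt_0_compat; lra|lra].
        right. f_equal. field. lra.
      - apply Rmult_le_compat_r. lra.
        destruct (Req_dec (x / c) 1) as [->|Hne].
        + unfold Rpower. rewrite ln_1, !Rmult_0_r. lra.
        + apply Rle_Rpower; trivial.
          assert (1 <= x / c).
          { apply Rmult_le_reg_r with c; trivial. unfold Rdiv. rewrite Rmult_assoc, Rinv_l; lra. }
          lra. }
    assert (U : wt nu z <= K * wt nu a * (x / c) ^ n).
    { apply Rmult_le_compat_r with (r := Rpower x al) in HU; [|lra].
      unfold Rdiv at 1 in HU. rewrite Rmult_assoc, Rinv_l, Rmult_1_r in HU by lra.
      eapply Rle_trans; [exact HU|].
      apply Rle_trans with (K * (wt nu a / Rpower c al) * ((x / c) ^ n * Rpower c al)).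
      - apply Rmult_le_compat_l; trivial. apply Rmult_le_pos. lra.
        apply Rmult_le_pos; trivial. left. now apply Rinv_0_lt_compat.
      - right. field. lra. }
    apply Rle_trans with (K * wt nu a * (x / c) ^ n * (c / d) ^ n).
    + apply Rmult_le_compat; trivial. apply Cmod_ge_0.
    + replace (K * wt nu a * (x / c) ^ n * (c / d) ^ n) with (K * wt nu a * (x / d) ^ n).
      2:{ replace (x / d) with (x / c * (c / d)) by (field; lra). rewrite Rpow_mult_distr. ring. }
      assert (X : (x / d) ^ n <= 2 ^ n) by (apply div_pow_le_2; unfold x; nra).
      apply Rle_trans with (K * wt nu a * 2 ^ n).
      * apply Rmult_le_compat_l; trivial. apply Rmult_le_pos; lra.
      * assert (0 <= wt nu a * 2 ^ n) by (apply Rmult_le_pos; lra). nra.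
Qed.

(** [Hnorm] applies [real] to an extended supremum, and [real] sends infinities to 0; a finite bound
    [M] makes it the true supremum. *)
Lemma Hnorm_spec (nu : R -> R) (f : C -> C) (M : R) : bounded_by nu f M ->
  bounded_by nu f (Hnorm nu f) /\ Hnorm nu f <= M.
Proof.
  intros HM. unfold Hnorm.
  set (E := fun x => exists z, inD z /\ x = wt nu z * Cmod (f z)).
  destruct (Lub_Rbar_correct E) as [U L].
  assert (LM : Rbar_le (Lub_Rbar E) M).
  { apply L. intros x (z & Hz & ->). now apply HM. }
  assert (UB : forall z, inD z -> Rbar_le (wt nu z * Cmod (f z)) (Lub_Rbar E)).
  { intros z Hz. apply U. now exists z. }
  destruct (Lub_Rbar E) as [r| |].
  - split; [exact UB|exact LM].
  - contradiction.
  - destruct (UB _ inD_0).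
Qed.

Lemma inH0_inHinf (nu : R -> R) (f : C -> C) : weight nu -> inH0 nu f -> inHinf nu f.
Proof.
  intros Hnu [Af Vf]. split; trivial. apply vanishes_bounded; trivial. now apply weight_profile.
Qed.

Lemma weight_pos_near (mu : R -> R) (a : C) : weight mu -> inD a -> 0 < wt mu a ->
  exists d, 0 < d /\ forall k, Cmod k < d -> inD (a + k) /\ 0 < wt mu (a + k).
Proof.
  intros (_ & Hc & _) Ha Hp. unfold inD in *. assert (Pa := Cmod_ge_0 a).
  destruct (Hc (Cmod a) ltac:(lra) (wt mu a) Hp) as (d & Hd & K).
  exists (Rmin d (1 - Cmod a)). split. apply Rmin_pos; lra. intros k Hk.
  assert (Q1 := Rmin_l d (1 - Cmod a)). assert (Q2 := Rmin_r d (1 - Cmod a)).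
  assert (T1 := Cmod_triangle a k). assert (T2 := Cmod_le_sub a (a + k)).
  replace (a - (a + k))%C with (- k)%C in T2 by ring. rewrite Cmod_opp in T2.
  assert (D1 : Cmod (a + k) < 1) by lra. split; trivial.
  assert (Pk := Cmod_ge_0 (a + k)). specialize (K (Cmod (a + k)) ltac:(lra)).
  assert (Rabs (Cmod (a + k) - Cmod a) < d) by (apply Rabs_lt_between; lra).
  specialize (K H). apply Rabs_lt_between in K. unfold wt in *. lra.
Qed.

(** A zero of [nu] spreads outwards by monotonicity and inwards by property (U). *)
Lemma propU_pos_or_zero (nu : R -> R) : weight nu -> propU nu ->
  (forall z, inD z -> 0 < wt nu z) \/ (forall z, inD z -> wt nu z = 0).
Proof.
  intros Hnu (al & Hal & K & HK & HU).
  destruct (classic (forall z, inD z -> 0 < wt nu z)) as [H|H]; [now left|right].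
  intros z Hz. assert (Pz := wt_ge_0 nu z (weight_profile _ Hnu) Hz).
  apply not_all_ex_not in H. destruct H as [w Hw]. apply imply_to_and in Hw. destruct Hw as [Hw Hw0].
  assert (Pw := wt_ge_0 nu w (weight_profile _ Hnu) Hw).
  assert (Ew : wt nu w = 0) by lra.
  destruct (Rle_lt_dec (Cmod w) (Cmod z)) as [L|L].
  - assert (T := wt_le nu z w (weight_profile _ Hnu) Hz L). lra.
  - specialize (HU (Cmod z) (Cmod w) (Cmod_ge_0 z) ltac:(lra) Hw).
    change (nu (Cmod z)) with (wt nu z) in HU. change (nu (Cmod w)) with (wt nu w) in HU.
    rewrite Ew in HU. unfold Rdiv in HU. rewrite Rmult_0_l, Rmult_0_r in HU.
    assert (R1 : 0 < Rpower (1 - Cmod z ^ 2) al) by apply exp_pos.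
    assert (0 < / Rpower (1 - Cmod z ^ 2) al) by now apply Rinv_0_lt_compat. nra.
Qed.

(** * Boundedness of [S_g] and the growth condition on [g] *)

Section Operator.

Context (g : C -> C) (nu mu : R -> R).
Context (Hg : analytic g) (Hnu : weight nu) (HU : propU nu) (Hmu : weight mu) (Hqn : quasi_normal mu).

(** Condition (2) with the denominator cleared, so that it has a meaning at zeros of [nu]: there it
    requires [mu |g|] to be zero. *)
Let cond2 : Prop := exists M, forall z, inD z -> wt mu z * Cmod (g z) <= M * wt nu z.

Lemma Sg_analytic (f : C -> C) : analytic f -> analytic (Sg g f).
Proof.
  intros Hf. apply cdiff_analytic with (fun z => Cderiv f z * g z)%C. intros z Hz. now apply Sg_cdiff.
Qed.

Lemma Sg_deriv (f : C -> C) (z : C) : analytic f -> inD z -> Cderiv (Sg g f) z = (Cderiv f z * g z)%C.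
Proof. intros Hf Hz. now apply Cderiv_eq, Sg_cdiff. Qed.

Lemma test_bound_sufficient (n : nat) (K : R) : 0 <= K ->
  (forall a, inD a -> bounded_by mu (Sg g (test_fun n a)) (K * wt nu a)) -> cond2.
Proof.
  intros PK HK. assert (Pmu := weight_profile _ Hmu). assert (Pnu := weight_profile _ Hnu).
  destruct (classic (exists r, 0 <= r < 1 /\ mu r <= 0)) as [(r & Hr & Hr0)|Hno].
  - destruct (propU_pos_or_zero nu Hnu HU) as [Hpos|Hzero].
    (* Only [|z| < r] matters, where [g] is bounded and [nu] is at least [nu r > 0]. *)
    + destruct (analytic_bounded g r Hg ltac:(lra)) as [M HM].
      assert (Pr : 0 < nu r).
      { specialize (Hpos (RtoC r)). unfold wt, inD in Hpos. rewrite Cmod_R, Rabs_pos_eq in Hpos by lra.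
        apply Hpos. lra. }
      exists (wt mu 0 * Rmax 0 M / nu r). intros z Hz. assert (Cz := Cmod_ge_0 z).
      assert (P0 : 0 <= wt mu 0 * Rmax 0 M).
      { apply Rmult_le_pos. now apply wt_ge_0, inD_0. apply Rmax_l. }
      destruct (Rle_lt_dec r (Cmod z)) as [Hrz|Hrz].
      * assert (E : wt mu z <= 0).
        { eapply Rle_trans; [|exact Hr0]. apply Pmu; trivial. lra. }
        assert (E' := wt_ge_0 mu z Pmu Hz). replace (wt mu z) with 0 by lra. rewrite Rmult_0_l.
        apply Rmult_le_pos. { apply Rmult_le_pos; trivial. left; now apply Rinv_0_lt_compat. }
        left. now apply Hpos.
      * apply Rle_trans with (wt mu 0 * Rmax 0 M).
        -- apply Rmult_le_compat. now apply wt_ge_0. apply Cmod_ge_0.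
           apply wt_le; trivial. now rewrite Cmod_0.
           eapply Rle_trans; [|apply Rmax_r]. apply HM. lra.
        -- assert (T : nu r <= wt nu z) by (apply Pnu; lra).
           apply Rmult_le_reg_r with (/ wt nu z).
           { apply Rinv_0_lt_compat. lra. }
           replace (wt mu 0 * Rmax 0 M / nu r * wt nu z * / wt nu z) with (wt mu 0 * Rmax 0 M * / nu r) by (field; lra).
           apply Rmult_le_compat_l; trivial. now apply Rinv_le_contravar.
    + exists 0. intros a Ha. rewrite Rmult_0_l.
      destruct (Rle_lt_dec (wt mu a) 0) as [Ha0|Ha0].
      { assert (E' := wt_ge_0 mu a Pmu Ha). replace (wt mu a) with 0 by lra. lra. }
      destruct (weight_pos_near mu a Hmu Ha Ha0) as (d & Hd & Near).
      specialize (HK a Ha). rewrite (Hzero a Ha), Rmult_0_r in HK.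
      (* Here [nu] is zero, so the hypothesis forces [mu |S_g f_a| = 0]; [mu] is positive around
         [a], hence [S_g f_a] vanishes there, and its derivative [g a / (1 - |a|^2)] is zero. *)
      assert (Z : forall k, Cmod k < d -> Sg g (test_fun n a) (a + k)%C = 0%C).
      { intros k Hk. destruct (Near k Hk) as [N1 N2]. specialize (HK _ N1).
        apply Cmod_eq_0. assert (P := Cmod_ge_0 (Sg g (test_fun n a) (a + k)%C)). nra. }
      assert (E : Cderiv (Sg g (test_fun n a)) a = 0%C).
      { apply Cderiv_eq. apply cdiff_ext_loc with (fun _ => RtoC 0) d; trivial.
        intros k Hk. symmetry. now apply Z. apply cdiff_const. }
      rewrite Sg_deriv, test_fun_deriv in E; trivial; [|now apply test_fun_analytic].
      assert (Pa : 0 < 1 - Cmod a ^ 2) by (unfold inD in Ha; assert (P := Cmod_ge_0 a); nra).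
      apply (f_equal Cmod) in E. rewrite Cmod_mult, Cmod_0, Cmod_R in E.
      apply Rmult_integral in E. destruct E as [E|E].
      * exfalso. apply Rinv_0_lt_compat in Pa. rewrite Rabs_pos_eq in E; lra.
      * rewrite E. lra.
  - destruct (value_to_derivative_pos mu Hmu Hqn) as (K' & PK' & HK').
    { intros r Hr. apply Rnot_le_lt. intros Hc. apply Hno. now exists r. }
    exists (K' * K). intros a Ha.
    assert (Pa : 0 < 1 - Cmod a ^ 2) by (unfold inD in Ha; assert (P := Cmod_ge_0 a); nra).
    assert (Ha' := test_fun_analytic n a Ha).
    specialize (HK' _ _ (Sg_analytic _ Ha') (Sg_0 g _) (HK a Ha) a Ha).
    rewrite Sg_deriv, test_fun_deriv, Cmod_mult, Cmod_R in HK' by trivial.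
    rewrite Rabs_pos_eq in HK' by (left; now apply Rinv_0_lt_compat).
    unfold wt at 1, mu1 in HK'. fold (wt mu a) in HK'.
    replace (wt mu a * (1 - Cmod a ^ 2) * (/ (1 - Cmod a ^ 2) * Cmod (g a))) with
      (wt mu a * Cmod (g a)) in HK' by (field; lra).
    lra.
Qed.

(** Source and target are abstract so that the lemma applies to both (1) and (3): the source has to
    contain the test functions, the target has to consist of functions with finite norm. *)
Lemma bounded_op_necessary (inX : (C -> C) -> Prop) (inY : (C -> C) -> Prop) :
  (forall n a, inD a -> inX (test_fun n a)) ->
  (forall f, inY f -> exists M, bounded_by mu f M) ->
  bounded_op inX inY nu mu (Sg g) -> cond2.
Proof.
  intros HX HY [K HK]. destruct (test_fun_norm nu Hnu HU) as (n & K' & PK' & HK').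
  (* The constant of [bounded_op] carries no sign, hence the absolute value. *)
  apply test_bound_sufficient with n (Rabs K * K').
  { apply Rmult_le_pos. apply Rabs_pos. lra. }
  intros a Ha z Hz. destruct (HK _ (HX n a Ha)) as [H1 H2].
  destruct (HY _ H1) as [M HM]. destruct (Hnorm_spec _ _ _ HM) as [HM' _].
  destruct (Hnorm_spec _ _ _ (HK' a Ha)) as [HB HL].
  eapply Rle_trans. apply (HM' z Hz). eapply Rle_trans. exact H2.
  assert (PH : 0 <= Hnorm nu (test_fun n a)).
  { eapply Rle_trans; [|apply (HB _ inD_0)]. apply Rmult_le_pos.
    apply wt_ge_0. now apply weight_profile. apply inD_0. apply Cmod_ge_0. }
  rewrite Rmult_assoc. apply Rle_trans with (Rabs K * Hnorm nu (test_fun n a)).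
  - apply Rmult_le_compat_r; trivial. apply Rle_abs.
  - apply Rmult_le_compat_l; trivial. apply Rabs_pos.
Qed.

Lemma Sg_norm : cond2 -> exists K, forall f, inHinf nu f ->
  inHinf mu (Sg g f) /\ Hnorm mu (Sg g f) <= K * Hnorm nu f.
Proof.
  intros [M HM]. destruct (derivative_to_value mu Hmu Hqn) as (K1 & PK1 & HK1).
  destruct (propU_derivative nu Hnu HU) as (K2 & PK2 & HK2).
  exists (K1 * (Rabs M * K2)). intros f [Af [N HN]].
  destruct (Hnorm_spec _ _ _ HN) as [HB _].
  assert (B : bounded_by mu (Sg g f) (K1 * (Rabs M * K2 * Hnorm nu f))).
  { apply HK1. now apply Sg_analytic. apply Sg_0. intros z Hz.
    rewrite Sg_deriv, Cmod_mult by trivial.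
    assert (T := HK2 f z (Hnorm nu f) Af Hz). 
    assert (T' : wt nu z * (1 - Cmod z ^ 2) * Cmod (Cderiv f z) <= K2 * Hnorm nu f).
    { apply T. intros w Hw. apply HB. unfold inD in *. assert (S := Cmod_le_sub w z). lra. }
    assert (Pz := Cmod_ge_0 z). assert (P1 : 0 <= 1 - Cmod z ^ 2) by (unfold inD in Hz; nra).
    unfold wt at 1, mu1. specialize (HM z Hz).
    assert (Pn := wt_ge_0 nu z (weight_profile _ Hnu) Hz).
    assert (X : wt mu z * Cmod (g z) <= Rabs M * wt nu z).
    { eapply Rle_trans. exact HM. apply Rmult_le_compat_r; trivial. apply Rle_abs. }
    replace (mu (Cmod z) * (1 - Cmod z ^ 2) * (Cmod (Cderiv f z) * Cmod (g z))) with
      (wt mu z * Cmod (g z) * ((1 - Cmod z ^ 2) * Cmod (Cderiv f z))) by (unfold wt; ring).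
    apply Rle_trans with (Rabs M * wt nu z * ((1 - Cmod z ^ 2) * Cmod (Cderiv f z))).
    - apply Rmult_le_compat_r; trivial. apply Rmult_le_pos; trivial. apply Cmod_ge_0.
    - apply Rmult_le_compat_l with (r := Rabs M) in T'; [|apply Rabs_pos]. lra. }
  split.
  - split. now apply Sg_analytic. eexists; exact B.
  - destruct (Hnorm_spec _ _ _ B) as [_ L]. lra.
Qed.

(** Membership comes from quasi-normality itself: it is enough that [mu_1 |f' g|] vanishes at the
    boundary, and near the boundary the local bound on [f'] involves only small values of
    [nu |f|]. *)
Lemma Sg_inH0 (f : C -> C) : cond2 -> inH0 nu f -> inH0 mu (Sg g f).
Proof.
  intros [M HM] [Af Vf]. apply Hqn. split. now apply Sg_analytic.
  destruct (propU_derivative nu Hnu HU) as (K2 & PK2 & HK2).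
  intros eps He. destruct (small_factor (eps / 2) (Rabs M * K2)) as (e & Hee & _ & He2); try lra.
  { apply Rmult_le_pos. apply Rabs_pos. lra. }
  destruct (Vf e Hee) as (d & Hd & K).
  (* For [|z|] beyond this radius, the disc of radius [(1 - |z|) / 2] about [z] stays outside the
     disc of radius [d]: [(3 |z| - 1) / 2 > d]. *)
  exists ((1 + 2 * Rmax 0 d) / 3). split. { assert (Rmax 0 d < 1) by (apply Rmax_lub_lt; lra). lra. }
  intros z Hz Hdz. rewrite Sg_deriv, Cmod_mult by trivial.
  assert (Rd := Rmax_r 0 d). 
  assert (T' : wt nu z * (1 - Cmod z ^ 2) * Cmod (Cderiv f z) <= K2 * e).
  { apply HK2; trivial. intros w Hw. left. unfold inD in Hz. apply K.
    - unfold inD. assert (S := Cmod_le_sub w z). lra.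
    - assert (S := Cmod_le_sub z w). rewrite Cmod_sub_swap in S. lra. }
  assert (Pz := Cmod_ge_0 z). assert (P1 : 0 <= 1 - Cmod z ^ 2) by (unfold inD in Hz; nra).
  unfold wt, mu1. specialize (HM z Hz).
  assert (Pn := wt_ge_0 nu z (weight_profile _ Hnu) Hz).
  assert (X : wt mu z * Cmod (g z) <= Rabs M * wt nu z).
  { eapply Rle_trans. exact HM. apply Rmult_le_compat_r; trivial. apply Rle_abs. }
  replace (mu (Cmod z) * (1 - Cmod z ^ 2) * (Cmod (Cderiv f z) * Cmod (g z))) with
    (wt mu z * Cmod (g z) * ((1 - Cmod z ^ 2) * Cmod (Cderiv f z))) by (unfold wt; ring).
  apply Rle_lt_trans with (Rabs M * wt nu z * ((1 - Cmod z ^ 2) * Cmod (Cderiv f z))).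
  - apply Rmult_le_compat_r; trivial. apply Rmult_le_pos; trivial. apply Cmod_ge_0.
  - apply Rmult_le_compat_l with (r := Rabs M) in T'; [|apply Rabs_pos]. lra.
Qed.

End Operator.

Lemma test_fun_inHinf (nu : R -> R) (n : nat) (a : C) : weight nu -> inD a -> inHinf nu (test_fun n a).
Proof.
  intros Hnu Ha. assert (Pnu := weight_profile _ Hnu). split. now apply test_fun_analytic.
  exists (wt nu 0 * 2 ^ n). intros z Hz. apply Rmult_le_compat. now apply wt_ge_0. apply Cmod_ge_0.
  apply wt_le; trivial. rewrite Cmod_0. apply Cmod_ge_0. now apply test_fun_le.
Qed.

Lemma test_fun_inH0 (nu : R -> R) (n : nat) (a : C) : weight nu -> typical nu -> inD a ->
  inH0 nu (test_fun n a).
Proof.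
  intros Hnu Ht Ha. split. now apply test_fun_analytic.
  intros eps He. assert (P2 : 0 < 2 ^ n) by (apply pow_lt; lra).
  destruct (Ht (eps / 2 ^ n)) as (d & Hd & K). now apply Rdiv_lt_0_compat.
  exists d. split; trivial. intros z Hz Hdz. specialize (K z Hz Hdz).
  assert (Pz := wt_ge_0 nu z (weight_profile _ Hnu) Hz).
  apply Rle_lt_trans with (wt nu z * 2 ^ n).
  - apply Rmult_le_compat_l; trivial. now apply test_fun_le.
  - apply Rmult_lt_reg_r with (/ 2 ^ n). now apply Rinv_0_lt_compat.
    rewrite Rmult_assoc, Rinv_r by lra. unfold Rdiv in K. lra.
Qed.

Theorem theorem3 (g : C -> C) (nu mu : R -> R) :
  analytic g -> weight nu -> propU nu -> weight mu -> quasi_normal mu ->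
  (bounded_op (inHinf nu) (inHinf mu) nu mu (Sg g)
     <-> (exists M, forall z, inD z -> wt mu z * Cmod (g z) <= M * wt nu z))
  /\
  (typical nu ->
     (bounded_op (inH0 nu) (inH0 mu) nu mu (Sg g)
        <-> (exists M, forall z, inD z -> wt mu z * Cmod (g z) <= M * wt nu z))).
Proof.
  intros Hg Hnu HU Hmu Hqn. split; [|intros Ht]; split; intros H.
  - apply (bounded_op_necessary g nu mu Hg Hnu HU Hmu Hqn) with (3 := H).
    + intros n a Ha. now apply test_fun_inHinf.
    + intros f [_ Hf]. exact Hf.
  - exact (Sg_norm g nu mu Hg Hnu HU Hmu Hqn H).
  - apply (bounded_op_necessary g nu mu Hg Hnu HU Hmu Hqn) with (3 := H).
    + intros n a Ha. now apply test_fun_inH0.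
    + intros f Hf. now apply inH0_inHinf.
  - destruct (Sg_norm g nu mu Hg Hnu HU Hmu Hqn H) as [K HK]. exists K. intros f Hf. split.
    + now apply Sg_inH0 with nu.
    + now apply HK, inH0_inHinf.
Qed.
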